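(* Let $A$ be the generator of an exponentially stable $C_0$-semigroup on a Hilbert space $H$, and suppose that $A^{-1}$ generates a bounded $C_0$-semigroup on $H$, i.e. $\sup_{t\ge0}\|e^{A^{-1}t}\|<\infty$. Let $(\tau_n)_{n\in\mathbb{N}_0}$ satisfy $0<\inf_n\tau_n\le\sup_n\tau_n<\infty$, and let $(x_n)_{n\in\mathbb{N}_0}$ be the solution of \[ x_{n+1}=A_d(\tau_n)x_n,\quad n\in\mathbb{N}_0,\qquad x_0\in H, \] where $A_d(\tau)\coloneqq\big(I+\tfrac{\tau}{2}A\big)\big(I-\tfrac{\tau}{2}A\big)^{-1}$. Then: (i) for each $0<\alpha<1$ there exists $K>0$ such that $\|x_n\|\le K n^{-\alpha/2}\|(-A)^{\alpha}x_0\|$ for all $x_0\in D((-A)^{\alpha})$ and all $n\ge1$; (ii) there exists $K>0$ such that $\|x_n\|\le K\sqrt{\tfrac{\log n}{n}}\,\|Ax_0\|$ for all $x_0\in D(A)$ and all $n\ge2$.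
   Context: $\mathbb{N}_0=\{0,1,2,\dots\}$. An exponentially stable $C_0$-semigroup satisfies $\|e^{At}\|\le Ke^{-\omega t}$ for some $K,\omega>0$; then $A^{-1}\in\mathcal{L}(H)$. $A_d(\tau)$ is the Cayley transform of $A$ (Crank–Nicolson scheme with step size $\tau$). $(-A)^{\alpha}$, $\alpha>0$, denotes the fractional power of $-A$ with domain $D((-A)^{\alpha})$. *)

(* Defs.v *)
From mathcomp Require Import all_boot all_order all_algebra.
From mathcomp Require Import all_classical all_reals all_analysis.
Import Order.TTheory GRing.Theory Num.Theory numFieldNormedType.Exports.
Local Open Scope classical_set_scope.
Local Open Scope ring_scope.

Set Implicit Arguments.
Unset Strict Implicit.
Unset Printing Implicit Defensive.

Section Defs.
Variables (R : realType) (H : completeNormedModType R).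

Definition inner_product (ip : H -> H -> R) : Prop :=
  (forall x y, ip x y = ip y x) /\
  (forall (a : R) x y z, ip (a *: x + y) z = a * ip x z + ip y z) /\
  (forall x, ip x x = `|x| ^+ 2).

(* T : [0,oo) -> L(H) is a C0-semigroup (values of T at t < 0 are irrelevant). *)
Definition C0_semigroup (T : R -> H -> H) : Prop :=
  (forall t (a : R) x y, 0 <= t -> T t (a *: x + y) = a *: T t x + T t y) /\
  (forall t, 0 <= t -> exists M : R, forall x, `|T t x| <= M * `|x|) /\
  (forall x, T 0 x = x) /\
  (forall s t x, 0 <= s -> 0 <= t -> T (s + t) x = T s (T t x)) /\
  (forall x, T t x @[t --> 0^'+] --> x).

(* graph of the generator A of T:  x \in D(A) and A x = y *)
Definition generator (T : R -> H -> H) (x y : H) : Prop :=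
  h^-1 *: (T h x - x) @[h --> 0^'+] --> y.

Definition exp_stable (T : R -> H -> H) : Prop :=
  exists K w : R, 0 < K /\ 0 < w /\
    forall t x, 0 <= t -> `|T t x| <= K * expR (- (w * t)) * `|x|.

Definition inv_generates_bounded (T : R -> H -> H) : Prop :=
  exists S : R -> H -> H, C0_semigroup S /\
    (forall x y, generator S x y <-> generator T y x) /\
    exists M : R, forall t x, 0 <= t -> `|S t x| <= M * `|x|.

(* x_{n+1} = A_d(tau_n) x_n with A_d(tau) = (I + tau/2 A)(I - tau/2 A)^{-1}:
   z = (I - tau/2 A)^{-1} x_n, and x_{n+1} = (I + tau/2 A) z. *)
Definition crank_nicolson (T : R -> H -> H) (tau : nat -> R) (x : nat -> H) : Prop :=
  forall n, exists z a, generator T z a /\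
    x n = z - (tau n / 2) *: a /\ x n.+1 = z + (tau n / 2) *: a.

Definition Gamma (a : R) : R :=
  Rintegral (@lebesgue_measure R) `]0, +oo[ (fun t => t `^ (a - 1) * expR (- t)).

(* x = (-A)^{-alpha} y = 1/Gamma(alpha) \int_0^oo t^{alpha-1} T(t) y dt
   (integral taken weakly); equivalently x \in D((-A)^alpha), (-A)^alpha x = y. *)
Definition neg_frac_pow (ip : H -> H -> R) (T : R -> H -> H) (alpha : R) (y x : H) : Prop :=
  forall w, ip x w = (Gamma alpha)^-1 *
    Rintegral (@lebesgue_measure R) `]0, +oo[ (fun t => t `^ (alpha - 1) * ip (T t y) w).

End Defs.

(* Main.v *)
(* Put s_n = tau_n / 2 and write a step as x_n = z - s_n a, x_{n+1} = z + s_n a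
   with a = A z.  A Lyapunov form B of A satisfies 2 B(z, A z) = -|z|^2, so
   B(x_{n+1}, x_{n+1}) - B(x_n, x_n) = 4 s_n B(z, a) = - 2 s_n |z|^2 and
   sum |z|^2 <= C |x_0|^2.  In the same way a form for A^{-1} - kap controls
   sum_{n < N} |a|^2 by C N |x_0|^2: the error 2 kap B(a, a) is absorbed by the
   weights (1 - 1/(2N))^n when kap is of order 1/N.  Hence
   sum_{n < N} |x_n|^2 <= C N |x_0|^2, and likewise for the adjoint scheme run
   backwards from x_N; since <x_n, y_{N-n}> does not depend on n,
   Cauchy-Schwarz gives |x_N| <= C |x_0|.

   If x_0 = A^{-1} b, then a runs through the vectors z of the orbit of b, so
   that sum |x_n|^2 <= C |b|^2, and power boundedness yields
   |x_n| <= C n^{-1/2} |b|, which is stronger than (ii).  Splitting the integral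
   defining (-A)^{-alpha} at t = n^{-1/2} interpolates this to (i).

   The Lyapunov forms are sums over powers of the resolvents (I - h A)^{-1};
   these pass to the adjoint without any continuity of the adjoint semigroup. *)
Require Import Defs.
From mathcomp Require Import all_boot all_order all_algebra.
From mathcomp Require Import all_classical all_reals all_analysis.
From mathcomp Require Import measurable_realfun ring lra.
Import Order.TTheory GRing.Theory Num.Theory numFieldNormedType.Exports.
Local Open Scope classical_set_scope.
Local Open Scope ring_scope.

Set Implicit Arguments.
Unset Strict Implicit.
Unset Printing Implicit Defensive.

(** * Riesz representation and adjoints *)

Section Hilbert.
Variables (R : realType) (H : completeNormedModType R).

(** The forms are Lyapunov forms only up to an error [eps], and only for vectors of norm at most
    [rho]. This suffices because a run of N steps meets finitely many vectors: they fix [rho], and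
    [eps] tends to 0 in the resulting inequality, so that no limit of forms is ever constructed.

    Boundedness of the semigroup of A^{-1} gives no decay, so the Lyapunov sum of A^{-1} itself may
    diverge. The shift by kap costs a factor M^2 / (2 kap), of order N. Duality tolerates exactly
    this loss: N equal pairings give N |x_N|^2 on one side, and sqrt(C N |x_0|^2) sqrt(C N |x_N|^2)
    on the other.

    The splitting point n^{-1/2} is a balance. With y = (-A)^alpha x_0, the orbit of y is merely
    bounded and contributes del^alpha on (0, del). Beyond del an integration by parts passes to the
    orbit of A^{-1} y, of size n^{-1/2}, and contributes n^{-1/2} del^(alpha - 1). *)

Definition lin (f : H -> H) : Prop :=
  forall (a : R) x y, f (a *: x + y) = a *: f x + f y.

Definition bilin (B : H -> H -> R) : Prop :=
  (forall x y, B x y = B y x) /\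
  (forall (a : R) x y z, B (a *: x + y) z = a * B x z + B y z).

Section Linear.
Variables (f : H -> H) (hf : lin f).

Lemma lin0 : f 0 = 0.
Proof. by have := hf (-1) 0 0; rewrite !scaleN1r oppr0 addr0 addNr. Qed.

Lemma linZ a x : f (a *: x) = a *: f x.
Proof. by have := hf a x 0; rewrite !addr0 lin0 addr0. Qed.

Lemma linD x y : f (x + y) = f x + f y.
Proof. by have := hf 1 x y; rewrite !scale1r. Qed.

Lemma linN x : f (- x) = - f x.
Proof. by rewrite -(scaleN1r x) linZ scaleN1r. Qed.

Lemma linB x y : f (x - y) = f x - f y.
Proof. by rewrite linD linN. Qed.

End Linear.

Section Bilinear.
Variables (B : H -> H -> R) (hB : bilin B).

Lemma bilC x y : B x y = B y x. Proof. by case: hB. Qed.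

Lemma bilDl x y z : B (x + y) z = B x z + B y z.
Proof. by have := hB.2 1 x y z; rewrite scale1r mul1r. Qed.

Lemma bil0l z : B 0 z = 0.
Proof. by have := bilDl 0 0 z; rewrite addr0; lra. Qed.

Lemma bilZl a x z : B (a *: x) z = a * B x z.
Proof. by have := hB.2 a x 0 z; rewrite addr0 bil0l addr0. Qed.

Lemma bilNl x z : B (- x) z = - B x z.
Proof. by rewrite -(scaleN1r x) bilZl mulN1r. Qed.

Lemma bilBl x y z : B (x - y) z = B x z - B y z.
Proof. by rewrite bilDl bilNl. Qed.

Lemma bilDr x y z : B z (x + y) = B z x + B z y.
Proof. by rewrite bilC bilDl !(bilC _ z). Qed.

Lemma bilZr a x z : B z (a *: x) = a * B z x.
Proof. by rewrite bilC bilZl (bilC _ z). Qed.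

Lemma bilNr x z : B z (- x) = - B z x.
Proof. by rewrite bilC bilNl (bilC _ z). Qed.

Lemma bilBr x y z : B z (x - y) = B z x - B z y.
Proof. by rewrite bilDr bilNr. Qed.

Lemma bil0r z : B z 0 = 0.
Proof. by rewrite bilC bil0l. Qed.

Lemma bil_quad s z a :
  B (z + s *: a) (z + s *: a) = B z z + 2 * s * B z a + s ^+ 2 * B a a.
Proof. by rewrite !bilDl !bilDr !bilZl !bilZr (bilC a z); ring. Qed.

Lemma bil_quadB s z a :
  B (z - s *: a) (z - s *: a) = B z z - 2 * s * B z a + s ^+ 2 * B a a.
Proof. by rewrite -scaleNr bil_quad; ring. Qed.

End Bilinear.

Variables (ip : H -> H -> R) (hip : inner_product ip).

Lemma ip_bil : bilin ip. Proof. by case: hip => h1 [h2 _]. Qed.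

Lemma ip_norm x : ip x x = `|x| ^+ 2. Proof. by case: hip => _ []. Qed.

Lemma ip_le x y : `|ip x y| <= `|x| * `|y|.
Proof.
have [->|y0] := eqVneq y 0.
  by rewrite (bil0r ip_bil) !normr0 mulr0.
have ny : 0 < `|y| by rewrite normr_gt0.
have := sqr_ge0 `|x - (ip x y / `|y| ^+ 2) *: y|.
rewrite -(ip_norm (x - _)) (bil_quadB ip_bil) !ip_norm => h.
rewrite -(@ler_pXn2r _ 2) ?nnegrE ?mulr_ge0// real_normK ?num_real//.
rewrite exprMn.
set u := ip x y in h *; set n := `|y| in h ny *.
have n0 : n != 0 by rewrite gt_eqF.
have : 0 <= (`|x| ^+ 2 - 2 * (u / n ^+ 2) * u + (u / n ^+ 2) ^+ 2 * n ^+ 2) * n ^+ 2.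
  by rewrite mulr_ge0// sqr_ge0.
suff -> : (`|x| ^+ 2 - 2 * (u / n ^+ 2) * u + (u / n ^+ 2) ^+ 2 * n ^+ 2) * n ^+ 2 = `|x| ^+ 2 * n ^+ 2 - u ^+ 2 by rewrite subr_ge0.
by field.
Qed.

Lemma ip_ge0 x : 0 <= ip x x.
Proof. by rewrite ip_norm sqr_ge0. Qed.

Lemma ip_young (t : R) x y : 0 < t -> 2 * ip x y <= t * ip x x + t^-1 * ip y y.
Proof.
move=> t0; have := ip_ge0 (t *: x - 1 *: y).
rewrite (bil_quadB ip_bil) !(bilZl ip_bil) !(bilZr ip_bil) => h.
have t1 : t != 0 by rewrite gt_eqF.
rewrite -subr_ge0.
have -> : t * ip x x + t^-1 * ip y y - 2 * ip x y =
  t^-1 * (t * (t * ip x x) - 2 * 1 * (t * ip x y) + 1 ^+ 2 * ip y y) by field.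
by rewrite mulr_ge0// invr_ge0 ltW.
Qed.

Lemma ip_ext x y : (forall w, ip x w = ip y w) -> x = y.
Proof.
move=> h; apply/eqP; rewrite -subr_eq0 -normr_eq0 -sqrf_eq0 -ip_norm.
by rewrite (bilBl ip_bil) h subrr.
Qed.

(** The [+ 1] allows a tolerance to be divided by a constant that may vanish; tolerances are chosen
    in this form throughout. *)
Lemma ratio_le (e d : R) : 0 <= e -> 0 <= d -> e / (d + 1) * d <= e.
Proof.
move=> e0 d0; have d1 : 0 < d + 1 by rewrite ltr_wpDl.
by rewrite mulrAC ler_pdivrMr// ler_wpM2l// lerDl.
Qed.

Lemma cvg_ip (U : Type) (F : set_system U) (FF : Filter F) (f : U -> H) x w :
  f @ F --> x -> ip (f u) w @[u --> F] --> ip x w.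
Proof.
move=> fx; apply/cvgrPdist_le => e e0.
have w1 : 0 < `|w| + 1 by rewrite ltr_wpDl.
have d0 : 0 < e / (`|w| + 1) by rewrite divr_gt0.
move/cvgrPdist_le: fx => /(_ _ d0); apply: filterS => u hu.
rewrite -(bilBl ip_bil) (le_trans (ip_le _ _))//.
by rewrite (le_trans (ler_wpM2r _ hu))// ratio_le// ltW.
Qed.

Lemma small_le0 (X Y D : R) : 0 <= D ->
  (forall e, 0 < e -> X <= Y + e * D) -> X <= Y.
Proof.
move=> D0 h; apply/ler_addgt0Pr => e e0.
have D1 : 0 < D + 1 by rewrite ltr_wpDl.
have := h (e / (D + 1)) (divr_gt0 e0 D1) => /le_trans; apply.
by rewrite lerD2l ratio_le// ltW.
Qed.

Lemma cauchy_seq_cvg (u : nat -> H) :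
  (forall e : R, 0 < e ->
     exists N, forall n k, (N <= n)%N -> (N <= k)%N -> `|u n - u k| < e) ->
  cvgn u.
Proof.
move=> hu; apply/cauchy_cvgP/cauchy_ballP => e e0; near_simpl.
have [N hN] := hu _ e0.
exists ([set n | (N <= n)%N], [set n | (N <= n)%N]); first by split; exists N.
by move=> [n k] [/= hn hk]; rewrite -ball_normE /ball_ /=; exact: hN.
Qed.

Lemma inv_small (e : R) : 0 < e ->
  exists N, forall n, (N <= n)%N -> n.+1%:R^-1 < e.
Proof.
move=> e0; have := @cvg_harmonic R => /cvgrPdist_lt /(_ _ e0) [N _ hN].
exists N => n /hN /=; rewrite sub0r normrN ger0_norm ?invr_ge0//.
Qed.

(** The representing vector minimizes [J x = |x|^2 / 2 - phi x]: minimizing sequences are Cauchy by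
    the parallelogram identity, and the first variation vanishes at the limit. *)
Lemma riesz (phi : H -> R) (M : R) :
  (forall (a : R) x y, phi (a *: x + y) = a * phi x + phi y) ->
  (forall x, `|phi x| <= M * `|x|) -> exists z, forall x, phi x = ip z x.
Proof.
move=> phil phib.
have phi0 : phi 0 = 0 by have := phil 1 0 0; rewrite scale1r addr0; lra.
have phiZ a x : phi (a *: x) = a * phi x by have := phil a x 0; rewrite !addr0 phi0 addr0.
have phiD x y : phi (x + y) = phi x + phi y by have := phil 1 x y; rewrite scale1r mul1r.
pose J (x : H) : R := ip x x / 2 - phi x.
have Jlb x : - (M ^+ 2 / 2) <= J x.
  have h1 : phi x <= M * `|x| by rewrite (le_trans (ler_norm _))// phib.
  have h2 := sqr_ge0 (M - `|x|); rewrite /J ip_norm.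
  move: (`|x|) h1 h2 => n h1 h2; nra.
have hasJ : has_inf (range J).
  split; first by exists (J 0), 0.
  by exists (- (M ^+ 2 / 2)) => _ [x _ <-].
set m := inf (range J).
have mJ x : m <= J x by apply: ge_inf; [case: hasJ|exists x].
have apx (n : nat) : exists x, J x < m + n.+1%:R^-1.
  have n0 : 0 < n.+1%:R^-1 :> R by rewrite invr_gt0.
  by have [_ [x _ <-] h] := inf_adherent n0 hasJ; exists x.
have [u hu] := choice apx.
(* The variational inequality is recorded along the sequence, so the passage to the limit only needs
   continuity of [ip] in its first argument. *)
have var n v t : 0 <= t * (ip (u n) v - phi v) + t ^+ 2 * (ip v v / 2) + n.+1%:R^-1.
  have := mJ (u n + t *: v); have := hu n.
  rewrite /J (bil_quad ip_bil) phiD phiZ; move: (n.+1%:R^-1) => i h1 h2; lra.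
have cau n k : ip (u n - u k) (u n - u k) <= 4 * (n.+1%:R^-1 + k.+1%:R^-1).
  have := hu n; have := hu k; have := mJ ((2^-1 : R) *: (u n + u k)).
  rewrite /J phiZ phiD (bilZl ip_bil) (bilZr ip_bil).
  rewrite !(bilDl ip_bil) !(bilDr ip_bil) !(bilNl ip_bil) !(bilNr ip_bil) (bilC ip_bil (u k) (u n)).
  by move: (n.+1%:R^-1) (k.+1%:R^-1) => i j h1 h2 h3; lra.
have cu : cvgn u.
  apply: cauchy_seq_cvg => e e0.
  have e8 : 0 < e ^+ 2 / 8 by rewrite divr_gt0// exprn_gt0.
  have [N hN] := inv_small e8.
  exists N => n k hn hk.
  rewrite -(@ltr_pXn2r _ 2) ?nnegrE// 1?ltW// -ip_norm.
  by move: (cau n k) (hN n hn) (hN k hk); move: (n.+1%:R^-1) (k.+1%:R^-1) => i j h1 h2 h3; lra.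
exists (limn u) => v.
have lim_u t : 0 <= t * (ip (limn u) v - phi v) + t ^+ 2 * (ip v v / 2).
  apply: (@cvgr_to_ge _ \oo _ _ (fun n => t * (ip (u n) v - phi v) + t ^+ 2 * (ip v v / 2) + n.+1%:R^-1)).
    rewrite -[X in _ --> X]addr0; apply: cvgD; last exact: cvg_harmonic.
    apply: cvgD; last exact: cvg_cst.
    apply: cvgM; first exact: cvg_cst.
    by apply: cvgB; [exact: cvg_ip|exact: cvg_cst].
  exact: nearW.
set d := ip _ v - phi v in lim_u.
suff : d = 0 by rewrite /d; lra.
have p0 : 0 < ip v v + 1 by rewrite ltr_wpDl// ip_ge0.
(* At this t the quadratic polynomial is a negative multiple of [d ^+ 2], which forces d = 0. *)
have h := lim_u (- (d / (ip v v + 1))).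
have e : (- (d / (ip v v + 1)) * d + (- (d / (ip v v + 1))) ^+ 2 * (ip v v / 2)) * (ip v v + 1) ^+ 2 = - (d ^+ 2 * (ip v v / 2 + 1)).
  by field; rewrite gt_eqF.
have : 0 <= - (d ^+ 2 * (ip v v / 2 + 1)) by rewrite -e mulr_ge0// sqr_ge0.
rewrite oppr_ge0 pmulr_lle0 ?ltr_wpDl ?divr_ge0 ?ip_ge0// => d0.
by apply/eqP; rewrite -sqrf_eq0 eq_le d0 sqr_ge0.
Qed.

Lemma adjoint_exists (f : H -> H) (M : R) : lin f ->
  (forall x, `|f x| <= M * `|x|) ->
  exists g, lin g /\ forall x y, ip (f x) y = ip x (g y).
Proof.
move=> hf fb.
have ex y : exists z, forall x, ip (f x) y = ip z x.
  apply: (@riesz _ (M * `|y|)) => [a x x'|x].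
    by rewrite hf (bilDl ip_bil) (bilZl ip_bil).
  by rewrite (le_trans (ip_le _ _))// mulrAC ler_wpM2r.
have [g hg] := choice ex; exists g.
have hg' x y : ip (f x) y = ip x (g y) by rewrite hg (bilC ip_bil).
split=> // a x y; apply: ip_ext => w.
rewrite (bilDl ip_bil) (bilZl ip_bil) !(bilC ip_bil _ w) -!hg'.
by rewrite (bilDr ip_bil) (bilZr ip_bil).
Qed.

Lemma adjoint_bound (f g : H -> H) (M : R) :
  (forall x y, ip (f x) y = ip x (g y)) ->
  (forall x, `|f x| <= M * `|x|) -> forall x, `|g x| <= M * `|x|.
Proof.
move=> fg fb x; have [->|g0] := eqVneq (g x) 0.
  by rewrite normr0 (le_trans _ (fb x)).
have gp : 0 < `|g x| by rewrite normr_gt0.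
rewrite -(ler_pM2l gp) -expr2 -ip_norm -fg (le_trans (ler_norm _))//.
rewrite (le_trans (ip_le _ _))// mulrA (mulrC `|g x|).
by rewrite ler_wpM2r.
Qed.

Lemma adjoint_iter (f g : H -> H) n :
  (forall x y, ip (f x) y = ip x (g y)) ->
  forall x y, ip (iter n f x) y = ip x (iter n g y).
Proof.
move=> fg; elim: n => [//|n IH] x y.
by rewrite iterS fg IH -iterSr.
Qed.

End Hilbert.
(** * Lyapunov forms *)

Section Resolvents.
Variables (R : realType) (H : completeNormedModType R).
Variables (ip : H -> H -> R) (hip : inner_product ip).
Let bip := ip_bil hip.

(* [A z a] encodes z \in D(A) and A z = a; [E] below is (I - h A)^{-1}. *)
Definition resolvents (K w : R) (A : H -> H -> Prop) : Prop :=
  forall h, 0 < h -> exists E : H -> H,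
    [/\ lin E, forall x, A (E x) (h^-1 *: (E x - x)),
        forall z a, A z a -> E (z - h *: a) = z &
        forall j x, `|iter j E x| <= K * (1 + w * h)^-1 ^+ j * `|x|].

(** The graph of the adjoint A^*; as a relation it makes sense before anything is known about the
    domain of A. *)
Definition adj_rel (A : H -> H -> Prop) (z' a' : H) : Prop :=
  forall z a, A z a -> ip a z' = ip z a'.

(** The adjoint of a resolvent of A is a resolvent of A^*, and an operator and its adjoint obey the
    same norm bounds. The bounds on all powers therefore survive with the same K and w. *)
Lemma resolvents_adj K w A : resolvents K w A -> resolvents K w (adj_rel A).
Proof.
move=> hA h h0; have [E [El EA AE Eb]] := hA h h0.
have E1 x : `|E x| <= (K * (1 + w * h)^-1) * `|x|.
  by have := Eb 1%N x; rewrite expr1.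
have [F [Fl EF]] := adjoint_exists hip El E1.
have h1 : h != 0 by rewrite gt_eqF.
exists F; split => //.
- move=> x z a Aza.
  rewrite -EF (bilZr bip) (bilBr bip) -EF.
  have : E z - z = h *: E a.
    by rewrite -[X in _ - X](AE _ _ Aza) (linB El) (linZ El) opprB addrCA subrr addr0.
  move=> Ez; rewrite -(bilBl bip) Ez (bilZl bip) mulrA mulVf// mul1r //.
- move=> z' a' A'; apply: (ip_ext hip) => x.
  rewrite (bilC bip) -EF (bilBr bip) (bilZr bip) -(A' _ _ (EA x)).
  rewrite (bilZl bip) mulrA divff// mul1r (bilBl bip) (bilC bip z') opprB addrCA subrr.
  by rewrite addr0.
- by move=> j; apply: (adjoint_bound hip (adjoint_iter j EF)).
Qed.

Lemma resolvents_iff K w A B : (forall z a, A z a <-> B z a) ->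
  resolvents K w A -> resolvents K w B.
Proof.
move=> AB hA h h0; have [E [El EA AE Eb]] := hA h h0; exists E; split => //.
  by move=> x; apply/AB.
by move=> z a /AB; apply: AE.
Qed.

(** With r = 1 / (1 + u), the inequality (1 + u)^2 >= 1 + 2 u gives 2 u r^2 <= 1 - r^2, and the sum
    telescopes. Taking u = w h, this bounds the Lyapunov form uniformly in h. *)
Lemma geo_sum_le (u : R) J : 0 < u ->
  2 * u * \sum_(j < J) ((1 + u)^-1 ^+ j.+1) ^+ 2 <= 1 - ((1 + u)^-1 ^+ J) ^+ 2.
Proof.
move=> u0; elim: J => [|J IH]; first by rewrite big_ord0 mulr0 expr0 expr1n subrr.
rewrite big_ord_recr /= mulrDr (le_trans (lerD IH (lexx _)))//.
rewrite (exprS _ J); set r := (1 + u)^-1; set q := r ^+ J.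
have r1 : r * (1 + u) = 1 by rewrite mulVf// gt_eqF// ltr_wpDl.
rewrite exprMn -subr_ge0.
have -> : 1 - r ^+ 2 * q ^+ 2 - (1 - q ^+ 2 + 2 * u * (r ^+ 2 * q ^+ 2)) =
  q ^+ 2 * ((r * (1 + u)) ^+ 2 - r ^+ 2 * (1 + 2 * u)) by rewrite r1; ring.
rewrite mulr_ge0 ?sqr_ge0//.
have -> : (r * (1 + u)) ^+ 2 - r ^+ 2 * (1 + 2 * u) = (r * u) ^+ 2 by ring.
exact: sqr_ge0.
Qed.

Lemma bernoulli (u : R) n : 0 <= u -> 1 + n%:R * u <= (1 + u) ^+ n.
Proof.
move=> u0; elim: n => [|n IH]; first by rewrite mul0r addr0 expr0.
rewrite exprS -natr1 (le_trans _ (ler_wpM2l _ IH)) ?addr_ge0//.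
have := ler0n R n; set m := n%:R => m0.
have := mulr_ge0 m0 (sqr_ge0 u); rewrite expr2; lra.
Qed.

Lemma pow_small (u e : R) : 0 < u -> 0 < e -> exists J, (1 + u)^-1 ^+ J < e.
Proof.
move=> u0 e0; pose J := (Num.truncn ((e * u)^-1)).+1; exists J.
have h := bernoulli J (ltW u0).
have hJ : (e * u)^-1 < J%:R by rewrite /J truncnS_gt.
have p : 0 < (1 + u) ^+ J by rewrite exprn_gt0// addr_gt0.
rewrite exprVn -[_^-1]mul1r ltr_pdivrMr//.
have : (e * u)^-1 * (e * u) < J%:R * (e * u).
  by rewrite ltr_pM2r// mulr_gt0.
rewrite mulVf ?gt_eqF ?mulr_gt0// => h2.
apply: lt_le_trans (ler_wpM2l (ltW e0) h).
by rewrite (lt_le_trans h2)// mulrDr mulr1 mulrCA -mulrCA lerDr ltW.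
Qed.

(* Discretized int_0^oo <e^{At} x, e^{At} y> dt, with e^{At} replaced by
   powers of the resolvent: a Lyapunov form for A up to an error [eps]. *)
Lemma lyapunov_form K w A (rho eps : R) : 0 < w -> 0 <= rho -> 0 < eps ->
  resolvents K w A -> exists B, [/\ bilin B,
    forall x, 0 <= B x x <= K ^+ 2 / (2 * w) * ip x x &
    forall z a, A z a -> `|z| <= rho -> `|a| <= rho ->
      2 * B z a <= - ip z z + eps].
Proof.
move=> w0 rho0 eps0 hA.
set D := K ^+ 2 / (2 * w).
have D0 : 0 <= D by rewrite divr_ge0 ?sqr_ge0// mulr_ge0// ltW.
(* Chosen so that the discretization error [h * B a a] is at most eps / 2. *)
pose h := eps / (2 * (D * rho ^+ 2 + 1)).
have Dr : 0 < 2 * (D * rho ^+ 2 + 1) by rewrite mulr_gt0// ltr_wpDl// mulr_ge0 ?sqr_ge0.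
have h0 : 0 < h by rewrite divr_gt0.
have [E [El EA AE Eb]] := hA h h0.
have wh0 : 0 < w * h by rewrite mulr_gt0.
pose Q := (K * (rho * (1 + h))) ^+ 2 + 1.
have Q0 : 0 < Q by rewrite ltr_wpDl// sqr_ge0.
(* [Q] bounds K^2 |z - h a|^2, so this threshold keeps the truncation error below eps / 2; the
   minimum with 1 lets the square of the small power be bounded by the power itself. *)
pose e1 := Num.min 1 (eps / (2 * Q)).
have e10 : 0 < e1 by rewrite lt_min ltr01 divr_gt0// mulr_gt0.
have [J hJ] := pow_small wh0 e10.
have sb j x : ip (iter j E x) (iter j E x) <=
    K ^+ 2 * ((1 + w * h)^-1 ^+ j) ^+ 2 * ip x x.
  rewrite !(ip_norm hip) -!exprMn lerXn2r ?nnegrE//.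
  by rewrite (le_trans _ (Eb j x)).
pose B x y := h * \sum_(j < J) ip (iter j.+1 E x) (iter j.+1 E y).
have iterl n a x y : iter n E (a *: x + y) = a *: iter n E x + iter n E y.
  by elim: n => // n IH; rewrite !iterS IH El.
have hB : bilin B.
  split=> [x y|a x y z].
    by rewrite /B; congr (_ * _); apply: eq_bigr => j _; rewrite (bilC bip).
  rewrite /B mulrCA -mulrDr; congr (_ * _).
  rewrite mulr_sumr -big_split /=.
  by apply: eq_bigr => j _; rewrite -!iterS iterl (bilDl bip) (bilZl bip).
have Bb x : 0 <= B x x <= D * ip x x.
  apply/andP; split.
    by rewrite mulr_ge0 ?(ltW h0)// sumr_ge0// => j _; exact: ip_ge0.
  have : B x x <= h * \sum_(j < J) (K ^+ 2 * ((1 + w * h)^-1 ^+ j.+1) ^+ 2 * ip x x).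
    by rewrite ler_wpM2l ?(ltW h0)// ler_sum.
  move=> /le_trans; apply.
  rewrite -mulr_suml -mulr_sumr mulrA ler_wpM2r ?(ip_ge0 hip)//.
  rewrite mulrCA /D ler_wpM2l ?sqr_ge0//.
  rewrite -[leRHS]mul1r ler_pdivlMr ?mulr_gt0//.
  have := geo_sum_le J wh0; set S := \sum_(_ < _) _ => hS.
  have := sqr_ge0 ((1 + w * h)^-1 ^+ J); lra.
exists B; split => // z a Aza zr ar.
have Ez := AE _ _ Aza.
set x := z - h *: a in Ez.
(* Since [E x = z], passing from x to z shifts all powers by one and the difference telescopes.
   Expanding [B x x] with x = z - h a then isolates [B z a]. *)
have tel : B x x - B z z = h * ip z z - h * ip (iter J.+1 E x) (iter J.+1 E x).
  rewrite /B -mulrBr -mulrBr; congr (_ * _).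
  rewrite -sumrB.
  pose f n := ip (iter n.+1 E x) (iter n.+1 E x).
  have itz j : iter j.+1 E z = iter j.+2 E x by rewrite [RHS]iterSr Ez.
  rewrite (eq_bigr (fun j : 'I_J => f j - f j.+1)) => [|j _]; last by rewrite itz.
  have -> : ip z z = f 0%N by rewrite /f /= Ez.
  rewrite -[ip _ _]/(f J) -(big_mkord xpredT (fun j => f j - f j.+1)).
  rewrite -opprB -(telescope_sumr f (leq0n J)) -sumrN.
  by apply: eq_bigr => j _; rewrite opprB.
rewrite (bil_quadB hB) in tel.
have e2 : 2 * B z a = - ip z z + h * B a a + ip (iter J.+1 E x) (iter J.+1 E x).
  have hn : h != 0 by rewrite gt_eqF.
  apply: (mulfI hn); rewrite !mulrDr; lra.
rewrite e2 -addrA lerD2l.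
have b1 : h * B a a <= eps / 2.
  have : B a a <= D * rho ^+ 2 + 1.
    case/andP: (Bb a) => _ /le_trans; apply.
    rewrite -[leLHS]addr0 lerD// ler_wpM2l// (ip_norm hip).
    by rewrite lerXn2r ?nnegrE.
  move=> /(ler_wpM2l (ltW h0)) /le_trans; apply.
  suff -> : h * (D * rho ^+ 2 + 1) = eps / 2 by [].
  by rewrite /h; field; have := Dr; rewrite pmulr_rgt0// => /lt0r_neq0.
have b2 : ip (iter J.+1 E x) (iter J.+1 E x) <= eps / 2.
  apply: le_trans (sb _ _) _.
  have xb : ip x x <= (rho * (1 + h)) ^+ 2.
    rewrite (ip_norm hip) lerXn2r ?nnegrE ?mulr_ge0 ?addr_ge0 ?(ltW h0)//.
    rewrite (le_trans (ler_normB _ _))// normrZ gtr0_norm// mulrDr mulr1 lerD//.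
    by rewrite mulrC ler_wpM2r// ltW.
  have r0 : 0 <= (1 + w * h)^-1 by rewrite invr_ge0 addr_ge0// ltW.
  have r1 : (1 + w * h)^-1 <= 1 by rewrite invf_le1 ?lerDl ?addr_gt0// ltW.
  have pe : ((1 + w * h)^-1 ^+ J.+1) ^+ 2 <= eps / (2 * Q).
    have p1 : (1 + w * h)^-1 ^+ J.+1 <= e1.
      rewrite exprS (le_trans _ (ltW hJ))// ler_piMl// exprn_ge0//.
    have p2 : (1 + w * h)^-1 ^+ J.+1 <= 1 by rewrite (le_trans p1)// /e1 ge_min lexx.
    rewrite expr2 (le_trans (ler_piMl _ p2)) ?exprn_ge0//.
    by rewrite (le_trans p1)// /e1 ge_min lexx orbT.
  rewrite mulrAC.
  apply: (@le_trans _ _ (Q * (eps / (2 * Q)))); last first.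
    suff -> : Q * (eps / (2 * Q)) = eps / 2 by [].
    by field; exact: lt0r_neq0.
  apply: ler_pM => //; [by apply: mulr_ge0; [exact: sqr_ge0|exact: ip_ge0]|exact: sqr_ge0|].
  rewrite /Q exprMn -[leLHS]addr0 lerD// ler_wpM2l ?sqr_ge0//.
by rewrite [leRHS](splitr eps) lerD.
Qed.

End Resolvents.
(** * Energy estimates for the scheme *)

Section Schemes.
Variables (R : realType) (H : completeNormedModType R).
Variables (ip : H -> H -> R) (hip : inner_product ip).
Let bip := ip_bil hip.

(** Stated for an arbitrary relation, so that the same estimates serve the scheme of A and that of
    its adjoint. *)
Definition steps (A : H -> H -> Prop) (s : nat -> R) (z a x : nat -> H) : Prop :=
  forall n, [/\ A (z n) (a n), x n = z n - s n *: a n &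
                x n.+1 = z n + s n *: a n].

Lemma steps_exist K w A s x0 : resolvents K w A -> (forall n, 0 < s n) ->
  exists z a x, steps A s z a x /\ x 0%N = x0.
Proof.
move=> hA s0.
have [E hE] := choice (fun n => hA (s n) (s0 n)).
(* The Cayley transform is 2 E - I, where E = (I - s A)^{-1}. *)
pose x := fix x n := if n is m.+1 then E m (x m) + (E m (x m) - x m) else x0.
exists (fun n => E n (x n)), (fun n => (s n)^-1 *: (E n (x n) - x n)), x.
split => // n; have [_ EA _ _] := hE n; split; first exact: EA.
  by rewrite scalerA divff ?gt_eqF// scale1r opprB addrCA subrr addr0.
by rewrite scalerA divff ?gt_eqF// scale1r.
Qed.

Lemma le_sum_one (f : nat -> R) N n : (n < N)%N -> (forall i, 0 <= f i) ->
  f n <= \sum_(i < N) f i.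
Proof.
move=> nN f0; rewrite (bigD1 (Ordinal nN))//= lerDl sumr_ge0//.
Qed.

Lemma onem_pow_ge (d : R) m : 0 <= d <= 1 -> 1 - m%:R * d <= (1 - d) ^+ m.
Proof.
case/andP => d0 d1; elim: m => [|m IH]; first by rewrite mul0r subr0 expr0.
rewrite exprS -(natr1 m); apply: le_trans (ler_wpM2l _ IH); last by rewrite subr_ge0.
have := ler0n R m; move: (m%:R) => k k0.
have := mulr_ge0 k0 (sqr_ge0 d); rewrite expr2 => h; lra.
Qed.

Section Energy.
Variables (K w M c C : R) (A : H -> H -> Prop).
Hypotheses (w0 : 0 < w) (c0 : 0 < c).
Hypothesis hA : resolvents K w A.
Hypothesis hAV : forall kap, 0 < kap ->
  resolvents M kap (fun v b => A (b + kap *: v) v).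
Variables (s : nat -> R) (z a x : nat -> H).
Hypothesis hs : forall n, c <= s n <= C.
Hypothesis hx : steps A s z a x.

Lemma energy_z N : 2 * c * \sum_(n < N) ip (z n) (z n) <=
  K ^+ 2 / (2 * w) * ip (x 0%N) (x 0%N).
Proof.
have C0 : 0 <= C by case/andP: (hs 0) => h1 h2; rewrite (le_trans _ h2)// (le_trans _ h1)// ltW.
apply: (@small_le0 _ _ _ (2 * C * N%:R)) => [|e e0]; first by rewrite !mulr_ge0.
(* A common bound for all vectors met in N steps. It does not depend on e, although the form
   does. *)
pose rho := \sum_(n < N) (`|z n| + `|a n|).
have rho0 : 0 <= rho by apply: sumr_ge0 => n _; rewrite addr_ge0.
have [B [hB Bb BL]] := lyapunov_form hip w0 rho0 e0 hA.
have key m : (m <= N)%N -> B (x m) (x m) + 2 * c * \sum_(n < m) ip (z n) (z n) <=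
    B (x 0%N) (x 0%N) + 2 * C * e * m%:R.
  elim: m => [_|m IH mN]; first by rewrite big_ord0 !mulr0 !addr0.
  have {}IH := IH (ltnW mN); rewrite big_ord_recr /= mulrDr -(natr1 m).
  have [Aza xm xm1] := hx m.
  have [cs sC] := andP (hs m).
  have le1 : `|z m| + `|a m| <= rho.
    by apply: (@le_sum_one (fun n => `|z n| + `|a n|)) => // i; rewrite addr_ge0.
  have h : 2 * B (z m) (a m) <= - ip (z m) (z m) + e.
    by apply: BL => //; apply: le_trans le1; rewrite (lerDl, lerDr).
  have tel : B (x m.+1) (x m.+1) = B (x m) (x m) + 2 * s m * (2 * B (z m) (a m)).
    by rewrite xm xm1 (bil_quad hB) (bil_quadB hB); ring.
  rewrite tel.
  have s0 : 0 <= s m by rewrite (le_trans (ltW c0)).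
  have h1 := ler_wpM2l s0 h.
  have h2 := ler_wpM2r (ip_ge0 hip (z m)) cs.
  have h3 := ler_wpM2r (ltW e0) sC.
  move: IH h1 h2 h3; move: (\sum_(_ < _) _) (ip _ _) (m%:R : R) (s m) => S p k sm IH h1 h2 h3.
  by lra.
have := key N (leqnn N).
have [BN _] := andP (Bb (x N)); have [_ B0] := andP (Bb (x 0%N)).
move: B0 BN; move: (\sum_(_ < _) _) (ip _ _) (N%:R : R) (K ^+ 2 / _) => S p k d h1 h2 h3.
by lra.
Qed.

(** The same argument with the roles of z and a exchanged, because z = A^{-1} a. The growth in N
    comes from the bound M^2 / (2 kap) of the form for A^{-1} - kap. *)
Lemma energy_a N : (0 < N)%N -> \sum_(n < N) ip (a n) (a n) <=
  8 * M ^+ 2 / c ^+ 2 * N%:R * ip (x 0%N) (x 0%N).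
Proof.
move=> N0.
have C0 : 0 <= C by case/andP: (hs 0) => h1 h2; rewrite (le_trans _ h2)// (le_trans _ h1)// ltW.
have Np : 0 < N%:R :> R by rewrite ltr0n.
have N1 : 1 <= N%:R :> R by rewrite ler1n.
pose kap := c / (8 * N%:R).
have kap0 : 0 < kap by rewrite divr_gt0// mulr_gt0.
pose d := (2 * N%:R : R)^-1.
have dN : d * N%:R = 2^-1 by rewrite /d; field; rewrite gt_eqF.
have d0 : 0 < d by rewrite invr_gt0 mulr_gt0.
have d1 : d <= 2^-1 by rewrite -dN ler_peMr// ltW.
(* This relation makes the absorption work: the error s (2 - d) 2 kap B(a, a) is at most 4 kap s
   B(a, a) = c d s B(a, a), hence at most d s^2 B(a, a), which the weight releases. The choice d = 1
   / (2N) keeps all weights between 1/2 and 1. *)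
have kd : 4 * kap = c * d by rewrite /kap /d; field; rewrite gt_eqF.
have MK : M ^+ 2 / (2 * kap) = c / 2 * (8 * M ^+ 2 / c ^+ 2 * N%:R).
  by rewrite /kap; field; rewrite !gt_eqF.
have c2 : 0 < c / 2 by rewrite divr_gt0.
rewrite -(ler_pM2l c2) mulrA -MK.
apply: (@small_le0 _ _ _ (2 * C * N%:R)) => [|e e0]; first by rewrite !mulr_ge0.
pose rho := \sum_(n < N) (`|a n| + `|z n - kap *: a n|).
have rho0 : 0 <= rho by apply: sumr_ge0 => n _; rewrite addr_ge0.
have [B [hB Bb BL]] := lyapunov_form hip kap0 rho0 e0 (hAV kap0).
have key m : (m <= N)%N ->
    (1 - d) ^+ m * B (x m) (x m) + c / 2 * \sum_(n < m) ip (a n) (a n) <=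
    B (x 0%N) (x 0%N) + 2 * C * e * m%:R.
  elim: m => [_|m IH mN]; first by rewrite big_ord0 expr0 mul1r !mulr0 !addr0.
  have {}IH := IH (ltnW mN); rewrite big_ord_recr /= mulrDr -(natr1 m).
  have [Aza xm xm1] := hx m.
  have [cs sC] := andP (hs m).
  have le1 : `|a m| + `|z m - kap *: a m| <= rho.
    by apply: (@le_sum_one (fun n => `|a n| + `|z n - kap *: a n|)) => // i; rewrite addr_ge0.
  have h : 2 * B (a m) (z m - kap *: a m) <= - ip (a m) (a m) + e.
    by apply: BL => //; rewrite ?subrK//; apply: le_trans le1; rewrite (lerDl, lerDr).
  rewrite (bilBr hB) (bilZr hB) (bilC hB) in h.
  have s0 : 0 <= s m by rewrite (le_trans (ltW c0)).
  have p1 : (1 - d) ^+ m <= 1 by rewrite exprn_ile1//; lra.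
  have p2 : 2^-1 <= (1 - d) ^+ m.
    have dd : 0 <= d <= 1 by apply/andP; split; lra.
    apply: le_trans (onem_pow_ge m dd).
    have : m%:R * d <= N%:R * d by rewrite ler_wpM2r ?(ltW d0)// ler_nat ltnW.
    by rewrite mulrC in dN; rewrite dN; lra.
  have one : (1 - d) * B (x m.+1) (x m.+1) - B (x m) (x m) <=
      - (c * ip (a m) (a m)) + 2 * C * e.
    rewrite xm xm1 (bil_quad hB) (bil_quadB hB).
    have [q0 _] := andP (Bb (z m)); have [q1 _] := andP (Bb (a m)).
    have i0 := ip_ge0 hip (a m).
    move: (B (z m) (a m)) (B (z m) (z m)) (B (a m) (a m)) (ip (a m) (a m)) q0 q1 i0 h => za zz aa ia q0 q1 i0 h.
    have t1 : 0 <= d * zz by rewrite mulr_ge0// ltW.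
    have s1 : 0 <= s m * (2 - d) by rewrite mulr_ge0//; lra.
    have t2 : s m * (2 - d) * (2 * za) <= s m * (2 - d) * (- ia + e + 2 * kap * aa).
      by rewrite ler_wpM2l//; lra.
    (* The shift error is absorbed here by the part of the weighted difference that is quadratic in
       a. *)
    have t3 : s m * (2 - d) * (2 * kap * aa) <= d * s m ^+ 2 * aa.
      have -> : d * s m ^+ 2 * aa = s m * aa * (d * s m) by ring.
      have -> : s m * (2 - d) * (2 * kap * aa) = s m * aa * ((2 - d) * (2 * kap)) by ring.
      rewrite ler_wpM2l// ?mulr_ge0//.
      have : d * c <= d * s m by rewrite ler_wpM2l// ltW.
      have : 0 <= d * kap by rewrite mulr_ge0// ltW.
      lra.
    have t4 : c * ia <= s m * (2 - d) * ia.
      rewrite ler_wpM2r//.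
      have : 0 <= s m * (1 - d) by rewrite mulr_ge0//; lra.
      lra.
    have t5 : s m * (2 - d) * e <= 2 * C * e.
      rewrite ler_wpM2r ?(ltW e0)//.
      have : 0 <= s m * d by rewrite mulr_ge0// ltW.
      lra.
    move: t1 t2 t3 t4 t5; set sd := s m * (2 - d) => t1 t2 t3 t4 t5.
    have -> : (1 - d) * (zz + 2 * s m * za + s m ^+ 2 * aa) -
        (zz - 2 * s m * za + s m ^+ 2 * aa) =
        - (d * zz) - d * s m ^+ 2 * aa + sd * (2 * za) by rewrite /sd; ring.
    lra.
  have p0 : 0 <= (1 - d) ^+ m by apply: le_trans p2; rewrite invr_ge0.
  have h1 := ler_wpM2l p0 one.
  have i0 : 0 <= c * ip (a m) (a m) by rewrite mulr_ge0 ?(ip_ge0 hip)// ltW.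
  have ce : 0 <= 2 * C * e by rewrite !mulr_ge0// ltW.
  have h2 := ler_wpM2r i0 p2.
  have h3 := ler_wpM2r ce p1.
  rewrite exprSr.
  move: IH h1 h2 h3 i0 ce; move: (\sum_(_ < _) _) (ip _ _) (m%:R : R) ((1 - d) ^+ m) (B (x m) _) (B (x m.+1) _) => S i k p b b1 IH h1 h2 h3 i0 ce.
  lra.
have := key N (leqnn N).
have [BN _] := andP (Bb (x N)); have [_ B0] := andP (Bb (x 0%N)).
have p0 : 0 <= (1 - d) ^+ N by rewrite exprn_ge0//; lra.
have := mulr_ge0 p0 BN.
move: B0; move: (_ * B _ _) (\sum_(_ < _) _) (ip _ _) (N%:R : R) (M ^+ 2 / _) => b S p k q h1 h2 h3.
lra.
Qed.

(** The first summand comes from [energy_z]; the second is 2 C^2 times the factor 8 M^2 / c^2 of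
    [energy_a]. *)
Definition energy_const := K ^+ 2 / (2 * w) / c + 16 * (M * C / c) ^+ 2.

Lemma energy_const_ge0 : 0 <= energy_const.
Proof.
apply: addr_ge0; last by rewrite mulr_ge0// sqr_ge0.
by rewrite !divr_ge0 ?sqr_ge0 ?mulr_ge0 ?(ltW w0) ?(ltW c0).
Qed.

Lemma sum_zza N : (0 < N)%N ->
  \sum_(n < N) (2 * ip (z n) (z n) + 2 * (C ^+ 2 * ip (a n) (a n))) <=
  energy_const * N%:R * ip (x 0%N) (x 0%N).
Proof.
move=> N0; rewrite big_split /= -!mulr_sumr.
have h1 := energy_z N; have h2 := energy_a N0.
have i0 := ip_ge0 hip (x 0%N).
have N1 : 1 <= N%:R :> R by rewrite ler1n.
have {}h1 : 2 * \sum_(n < N) ip (z n) (z n) <= K ^+ 2 / (2 * w) / c * N%:R * ip (x 0%N) (x 0%N).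
  have q0 : 0 <= K ^+ 2 / (2 * w) * ip (x 0%N) (x 0%N) / c.
    rewrite divr_ge0 ?(ltW c0)//; apply: mulr_ge0 => //.
    by rewrite divr_ge0 ?sqr_ge0 ?mulr_ge0 ?(ltW w0).
  have : 2 * \sum_(n < N) ip (z n) (z n) <= K ^+ 2 / (2 * w) * ip (x 0%N) (x 0%N) / c.
    by rewrite ler_pdivlMr// mulrC mulrA (mulrC c).
  move=> /le_trans; apply.
  have -> : K ^+ 2 / (2 * w) / c * N%:R * ip (x 0%N) (x 0%N) =
    K ^+ 2 / (2 * w) * ip (x 0%N) (x 0%N) / c * N%:R by ring.
  by rewrite ler_peMr.
have {}h2 := ler_wpM2l (mulr_ge0 (ler0n R 2) (sqr_ge0 C)) h2.
rewrite [X in _ + X <= _]mulrA; apply: le_trans (lerD h1 h2) _.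
suff -> : K ^+ 2 / (2 * w) / c * N%:R * ip (x 0%N) (x 0%N) +
    2 * C ^+ 2 * (8 * M ^+ 2 / c ^+ 2 * N%:R * ip (x 0%N) (x 0%N)) =
  energy_const * N%:R * ip (x 0%N) (x 0%N) by [].
by rewrite /energy_const; field; rewrite !gt_eqF.
Qed.

(** Parallelogram identity for z + s a and z - s a, with s <= C: one quantity controls both ends of
    a step. *)
Lemma step_norm n :
  ip (x n) (x n) <= 2 * ip (z n) (z n) + 2 * (C ^+ 2 * ip (a n) (a n)) /\
  ip (x n.+1) (x n.+1) <= 2 * ip (z n) (z n) + 2 * (C ^+ 2 * ip (a n) (a n)).
Proof.
have [_ -> ->] := hx n; rewrite (bil_quad bip) (bil_quadB bip).
have [cs sC] := andP (hs n).
have sn0 : 0 <= s n by rewrite (le_trans (ltW c0)).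
have sq : s n ^+ 2 * ip (a n) (a n) <= C ^+ 2 * ip (a n) (a n).
  by rewrite ler_wpM2r ?(ip_ge0 hip)// lerXn2r ?nnegrE// (le_trans sn0).
have := ip_ge0 hip (z n + s n *: a n); have := ip_ge0 hip (z n - s n *: a n).
by rewrite (bil_quad bip) (bil_quadB bip) => h1 h2; split; lra.
Qed.

End Energy.

Lemma shift_adj M A :
  (forall kap, 0 < kap -> resolvents M kap (fun v b => A (b + kap *: v) v)) ->
  forall kap, 0 < kap ->
    resolvents M kap (fun v b => adj_rel ip A (b + kap *: v) v).
Proof.
move=> h kap kap0; apply: resolvents_iff (resolvents_adj hip (h _ kap0)) => v' b'.
split=> hh z a Aza.
  have := hh a (z - kap *: a); rewrite subrK => /(_ Aza).
  by rewrite (bilBl bip) (bilDr bip) (bilZl bip) (bilZr bip) => <-; rewrite subrK.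
have := hh _ _ Aza.
by rewrite (bilDr bip) (bilDl bip) (bilZl bip) (bilZr bip) => /addIr ->.
Qed.

(** * Power boundedness by duality, and decay for initial data in the domain *)

Section PowerBounded.
Variables (K w M c C : R) (A : H -> H -> Prop).
Hypotheses (w0 : 0 < w) (c0 : 0 < c).
Hypothesis hA : resolvents K w A.
Hypothesis hAV : forall kap, 0 < kap ->
  resolvents M kap (fun v b => A (b + kap *: v) v).

Let CE := energy_const K w M c C + 1.

Lemma power_bounded s z a x N : (forall n, c <= s n <= C) -> steps A s z a x ->
  ip (x N) (x N) <= CE ^+ 2 * ip (x 0%N) (x 0%N).
Proof.
move=> hs hx.
have CE1 : 1 <= CE by rewrite lerDr energy_const_ge0.
have CE0 : 0 < CE by rewrite (lt_le_trans ltr01).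
case: N => [|N'].
  by rewrite ler_peMl ?(ip_ge0 hip)// exprn_ege1.
set N := N'.+1.
(* The step sizes are reversed, so that the adjoint step from y_{N-n-1} to y_{N-n} uses the same s_n
   as the step from x_n to x_{n+1}. *)
pose s' k := s (N - k.+1)%N.
have s'0 k : 0 < s' k by have /andP[h _] := hs (N - k.+1)%N; exact: lt_le_trans h.
have [z' [a' [y [hy y0]]]] := steps_exist (x N) (resolvents_adj hip hA) s'0.
have hs' k : c <= s' k <= C by exact: hs.
have inv n : (n < N)%N -> ip (x n.+1) (y (N - n.+1)%N) = ip (x n) (y (N - n)%N).
  move=> nN; have [Aza -> ->] := hx n; have [A' e1 e2] := hy (N - n.+1)%N.
  have es : s' (N - n.+1)%N = s n by rewrite /s' -subSn// subSS subKn// ltnW.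
  rewrite -subSn// subSS in e2; rewrite e2 e1 es.
  have ad := A' _ _ Aza.
  rewrite !(bilDl bip) !(bilDr bip) !(bilNl bip) !(bilNr bip).
  rewrite !(bilZl bip) !(bilZr bip) !ad; ring.
have cst n : (n <= N)%N -> ip (x n) (y (N - n)%N) = ip (x N) (x N).
  move=> nN; have -> : ip (x N) (x N) = ip (x N) (y (N - N)%N) by rewrite subnn y0.
  have [k] := ubnP (N - n); elim: k n nN => // k IH n nN hk.
  move: nN; rewrite leq_eqVlt => /orP[/eqP ->//|nN].
  rewrite -inv// IH//.
  by rewrite -ltnS (leq_trans _ hk)// -subSn// subSS.
have sumx : \sum_(n < N) ip (x n.+1) (x n.+1) <= CE * N%:R * ip (x 0%N) (x 0%N).
  apply: (@le_trans _ _ (energy_const K w M c C * N%:R * ip (x 0%N) (x 0%N))); last first.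
    by rewrite !ler_wpM2r ?(ip_ge0 hip)// lerDl.
  rewrite (le_trans _ (sum_zza w0 c0 hA hAV hs hx _))//.
  by apply: ler_sum => n _; have [] := step_norm c0 hs hx n.
have sumy : \sum_(n < N) ip (y n) (y n) <= CE * N%:R * ip (x N) (x N).
  apply: (@le_trans _ _ (energy_const K w M c C * N%:R * ip (x N) (x N))); last first.
    by rewrite !ler_wpM2r ?(ip_ge0 hip)// lerDl.
  rewrite -y0 (le_trans _ (sum_zza w0 c0 (resolvents_adj hip hA) (shift_adj hAV) hs' hy _))//.
  by apply: ler_sum => n _; have [] := step_norm c0 hs' hy n.
have main : 2 * (N%:R * ip (x N) (x N)) <=
    CE * (CE * N%:R * ip (x 0%N) (x 0%N)) + CE^-1 * (CE * N%:R * ip (x N) (x N)).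
  have -> : N%:R * ip (x N) (x N) = \sum_(n < N) ip (x n.+1) (y (N - n.+1)%N).
    under eq_bigr do rewrite cst//.
    by rewrite sumr_const card_ord mulr_natl.
  (* Young's inequality with weight [CE]: the y-sum then costs N |x_N|^2, which is half of the left
     side and is absorbed there. *)
  apply: (@le_trans _ _ (CE * \sum_(n < N) ip (x n.+1) (x n.+1) + CE^-1 * \sum_(n < N) ip (y n) (y n))); last first.
    by rewrite lerD// ler_wpM2l// ?invr_ge0 ltW.
  rewrite [\sum_(n < N) ip (y n) _](reindex_inj rev_ord_inj) /=.
  rewrite !mulr_sumr -big_split; apply: ler_sum => n _.
  exact: (ip_young hip _ _ CE0).
have Np : 0 < N%:R :> R by rewrite ltr0n.
rewrite -(ler_pM2l Np); move: main.
have -> : CE^-1 * (CE * N%:R * ip (x N) (x N)) = N%:R * ip (x N) (x N).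
  by rewrite -[CE * _ * _]mulrA mulKf// gt_eqF.
have -> : CE * (CE * N%:R * ip (x 0%N) (x 0%N)) = N%:R * (CE ^+ 2 * ip (x 0%N) (x 0%N)) by ring.
move: (N%:R * ip _ _) (N%:R * (_ * _)) => u v h; lra.
Qed.

(** Boundedness of A^{-1}, read off the Lyapunov form: |z|^2 is at most -2 B(z, a) up to e, and
    nonnegativity of B at a + t z bounds this by B(a, a) / t + t B(z, z). For t = 1 / (2 (D + 1))
    the last term is at most |z|^2 / 2. *)
Lemma inverse_bound z a : A z a ->
  ip z z <= 4 * (K ^+ 2 / (2 * w) * (K ^+ 2 / (2 * w) + 1)) * ip a a.
Proof.
move=> Aza; set D := K ^+ 2 / (2 * w).
have D0 : 0 <= D by rewrite divr_ge0 ?sqr_ge0// mulr_ge0// ltW.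
apply: (@small_le0 _ _ _ 2) => // e e0.
have rho0 : 0 <= `|z| + `|a| by rewrite addr_ge0.
have [B [hB Bb BL]] := lyapunov_form hip w0 rho0 e0 hA.
have h : 2 * B z a <= - ip z z + e by apply: BL => //; rewrite (lerDl, lerDr).
have D1 : 0 < 2 * (D + 1) by rewrite mulr_gt0// ltr_wpDl.
have [B0 _] := andP (Bb (a + (2 * (D + 1))^-1 *: z)).
have [_ Bz] := andP (Bb z); have [_ Ba] := andP (Bb a).
rewrite (bil_quad hB) (bilC hB a z) in B0.
set t := (2 * (D + 1))^-1 in B0 *.
have tD : t * (2 * (D + 1)) = 1 by rewrite /t mulVf// gt_eqF.
have := mulr_ge0 (ltW D1) B0.
have -> : 2 * (D + 1) * (B a a + 2 * t * B z a + t ^+ 2 * B z z) =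
  2 * (D + 1) * B a a + (t * (2 * (D + 1))) * (2 * B z a) + (t * (2 * (D + 1))) * t * B z z by ring.
rewrite tD !mul1r => h1.
have h2 := ler_wpM2l (ltW D1) Ba.
have t0 : 0 <= t by rewrite /t invr_ge0 ltW.
have h3 := ler_wpM2l t0 Bz.
have i0 := ip_ge0 hip z.
have h4 : t * (D * ip z z) <= 2^-1 * ip z z.
  rewrite mulrA ler_wpM2r//; lra.
rewrite -/D in h2 h3 *.
lra.
Qed.

Hypothesis Alin : forall k z a z' a', A z a -> A z' a' -> A (k *: z + z') (k *: a + a').

(** A commutes with the scheme. Applying the resolvent to x - s b, where b = A x, gives x = z - s
    z'; comparison with x = z - s a yields a = z'. Sums of |a|^2 thus become sums covered by
    [energy_z]. *)
Lemma steps_lift s z a x z' a' b : (forall n, 0 < s n) ->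
  steps A s z a x -> steps A s z' a' b -> A (x 0%N) (b 0%N) ->
  forall n, A (x n) (b n) /\ a n = z' n.
Proof.
move=> s0 hx hb h0.
have az n : A (x n) (b n) -> a n = z' n.
  move=> Axb; have [E [El _ AE _]] := hA (s0 n).
  have [Aza xn _] := hx n; have [Ab bn _] := hb n.
  have e1 : E (x n) = z n by rewrite xn AE.
  have e2 : E (b n) = z' n by rewrite bn AE.
  have := AE _ _ Axb; rewrite (linB El) (linZ El) e1 e2 => e3.
  have : s n *: a n = s n *: z' n.
    by apply: (addrI (- z n)); apply: oppr_inj; rewrite !opprD !opprK e3 xn.
  by move/scalerI; apply; rewrite gt_eqF.
elim=> [|n [Axb e]]; first by split => //; exact: az.
have h : A (x n.+1) (b n.+1).
  have [Aza _ ->] := hx n; have [Ab _ ->] := hb n.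
  rewrite e in Aza *.
  by rewrite addrC [X in A _ X]addrC; apply: Alin.
by split => //; exact: az.
Qed.

Lemma graph_decay : exists2 D, 0 < D & forall s z a x b N,
  (forall n, c <= s n <= C) -> steps A s z a x -> A (x 0%N) b ->
  N%:R * ip (x N) (x N) <= D * ip b b.
Proof.
pose D0 := K ^+ 2 / (2 * w).
have D00 : 0 <= D0 by rewrite divr_ge0 ?sqr_ge0// mulr_ge0// ltW.
pose G := 4 * (D0 * (D0 + 1)).
have G0 : 0 <= G by rewrite mulr_ge0// mulr_ge0// addr_ge0.
have L0 : 0 <= D0 / c * (G + C ^+ 2).
  by rewrite mulr_ge0 ?(addr_ge0 G0) ?sqr_ge0// divr_ge0// ltW.
(* [G] is the bound of [inverse_bound]: the z-sum costs D0 |x_0|^2 <= D0 G |b|^2, the a-sum D0 C^2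
   |b|^2. The [+ 1] provides strict positivity. *)
exists (CE ^+ 2 * (D0 / c * (G + C ^+ 2)) + 1).
  by rewrite ltr_wpDl// mulr_ge0// sqr_ge0.
move=> s z a x b N hs hx Axb.
have s0 n : 0 < s n by have /andP[h _] := hs n; exact: lt_le_trans h.
have [z' [a' [y [hy y0]]]] := steps_exist b hA s0.
rewrite -y0 in Axb *.
have lift := steps_lift s0 hx hy Axb.
have e1 := energy_z w0 c0 hA hs hx N.
have e2 := energy_z w0 c0 hA hs hy N.
have e3 := inverse_bound Axb.
have c20 : 0 < 2 * c by rewrite mulr_gt0.
have sumx : \sum_(n < N) ip (x n) (x n) <= D0 / c * (G + C ^+ 2) * ip (y 0%N) (y 0%N).
  apply: (@le_trans _ _ (\sum_(n < N) (2 * ip (z n) (z n) + 2 * (C ^+ 2 * ip (z' n) (z' n))))).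
    by apply: ler_sum => n _; have [h _] := step_norm c0 hs hx n; rewrite -(lift n).2.
  rewrite big_split /= -!mulr_sumr.
  rewrite -(ler_pM2l c0).
  have {}e2 := ler_wpM2l (sqr_ge0 C) e2.
  have {}e3 := ler_wpM2l D00 e3.
  have -> : c * (D0 / c * (G + C ^+ 2) * ip (y 0%N) (y 0%N)) =
    D0 * (G * ip (y 0%N) (y 0%N)) + C ^+ 2 * (D0 * ip (y 0%N) (y 0%N)).
    by field; rewrite gt_eqF.
  move: e1 e2 e3; rewrite -/D0 -/G.
  set S1 := \sum_(n < N) ip (z n) (z n).
  set S2 := \sum_(n < N) ip (z' n) (z' n) => e1 e2 e3.
  lra.
(* A scheme restarted at step n has step sizes in the same range, so [power_bounded] applies to it.
   Summing over n < N turns the bounded energy into a factor 1 / N. *)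
have tail n : (n <= N)%N -> ip (x N) (x N) <= CE ^+ 2 * ip (x n) (x n).
  move=> nN.
  have hx' : steps A (fun k => s (n + k)%N) (fun k => z (n + k)%N)
      (fun k => a (n + k)%N) (fun k => x (n + k)%N).
    by move=> k; rewrite addnS; exact: hx.
  have := power_bounded (N - n) (fun k => hs (n + k)%N) hx'.
  by rewrite subnKC// addn0.
apply: (@le_trans _ _ (CE ^+ 2 * \sum_(n < N) ip (x n) (x n))).
  rewrite mulr_sumr mulr_natl -[X in _ *+ X](card_ord N) -sumr_const.
  by apply: ler_sum => n _; apply: tail; rewrite ltnW.
apply: le_trans (ler_wpM2l (sqr_ge0 CE) sumx) _.
rewrite [leRHS]mulrDl mul1r -[X in _ <= X + _]mulrA lerDl.
exact: ip_ge0.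
Qed.

End PowerBounded.
End Schemes.
(** * Semigroups and generators *)

Section Semigroups.
Variables (R : realType) (H : completeNormedModType R).

Lemma near0r (P : R -> Prop) : (\forall h \near 0^'+, P h) <->
  exists2 e, 0 < e & forall h, 0 < h < e -> P h.
Proof.
split.
  move=> [e /= e0 he]; exists e => // h /andP[h0 h1]; apply: he => //=.
  by rewrite sub0r normrN gtr0_norm.
move=> [e e0 he]; exists e => //= h /=; rewrite sub0r normrN => h1 h0.
by apply: he; rewrite h0 /= -(gtr0_norm h0).
Qed.

Lemma generatorP (T : R -> H -> H) x y : generator T x y <->
  forall e, 0 < e -> exists2 d, 0 < d &
    forall h, 0 < h < d -> `|h^-1 *: (T h x - x) - y| <= e.
Proof.
split=> [g e e0|g].
  move/cvgrPdist_le: g => /(_ _ e0) /near0r[d d0 hd]; exists d => // h /hd.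
  by rewrite distrC.
apply/cvgrPdist_le => e e0; apply/near0r; have [d d0 hd] := g _ e0.
by exists d => // h /hd; rewrite distrC.
Qed.

Lemma expRN_le (u : R) : 0 <= u -> expR (- u) <= (1 + u)^-1.
Proof.
move=> u0; rewrite expRN lef_pV2 ?posrE ?expR_gt0 ?ltr_wpDr//.
exact: expR_ge1Dx.
Qed.

Lemma expR_tangent (u : R) : `|u| <= 2^-1 -> `|expR (- u) - 1 + u| <= 2 * u ^+ 2.
Proof.
rewrite ler_norml => /andP[u1 u2].
have h1 := expR_ge1Dx (- u); have h2 := expR_ge1Dx u.
have e0 := expR_gt0 u.
have p : 0 < 1 + u by lra.
have : expR (- u) <= (1 + u)^-1 by rewrite expRN lef_pV2 ?posrE.
have : (1 + u)^-1 <= 1 - u + 2 * u ^+ 2.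
  rewrite -[leLHS]mul1r ler_pdivrMr//.
  have := mulr_ge0 (sqr_ge0 u) (_ : 0 <= 1 + 2 * u); rewrite (_ : 0 <= 1 + 2 * u); last by lra.
  by move=> /(_ isT); rewrite !expr2; lra.
by move=> h3 h4; rewrite ger0_norm; lra.
Qed.

(** This semigroup has generator A - lam. It is used with lam = kap on the semigroup of A^{-1}, and
    with lam = 1 / h to solve the resolvent equation. *)
Definition rescale (lam : R) (T : R -> H -> H) (t : R) (x : H) : H :=
  expR (- (lam * t)) *: T t x.

Lemma rescaleK lam T : rescale (- lam) (rescale lam T) = T.
Proof.
apply/funext => t; apply/funext => x.
by rewrite /rescale scalerA -expRD mulNr opprK subrr expR0 scale1r.
Qed.

Definition exp_bounded (K w : R) (T : R -> H -> H) : Prop :=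
  forall t x, 0 <= t -> `|T t x| <= K * expR (- (w * t)) * `|x|.

Lemma rescale_bounded K w lam T : exp_bounded K w T ->
  exp_bounded K (w + lam) (rescale lam T).
Proof.
move=> Tb t x t0; rewrite normrZ gtr0_norm ?expR_gt0//.
have -> : K * expR (- ((w + lam) * t)) * `|x| =
    expR (- (lam * t)) * (K * expR (- (w * t)) * `|x|).
  by rewrite mulrDl opprD expRD; ring.
by rewrite ler_wpM2l ?expR_ge0// Tb.
Qed.

Lemma expRN_cvg1 (lam : R) : expR (- (lam * h)) @[h --> 0^'+] --> (1 : R).
Proof.
apply: cvg_at_right_filter.
have h : expR (- (lam * h)) @[h --> (0 : R)] --> expR (- (lam * 0)).
  apply: continuous_cvg; first exact: continuous_expR.
  by apply: cvgN; apply: cvgMl_tmp; exact: cvg_id.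
by move: h; rewrite mulr0 oppr0 expR0.
Qed.

Lemma expRN_diff (lam : R) :
  h^-1 * (expR (- (lam * h)) - 1) @[h --> 0^'+] --> - lam.
Proof.
apply/cvgrPdist_le => e e0; apply/near0r.
have l0 : 0 < `|lam| + 1 by rewrite ltr_wpDl.
have q0 : 0 < 2 * lam ^+ 2 + 1 by rewrite ltr_wpDl// mulr_ge0// sqr_ge0.
exists (Num.min (2 * (`|lam| + 1))^-1 (e / (2 * lam ^+ 2 + 1))).
  by rewrite lt_min invr_gt0 divr_gt0// mulr_gt0.
move=> h /andP[h0]; rewrite lt_min => /andP[h1 h2].
have u2 : `|lam * h| <= 2^-1.
  rewrite normrM (gtr0_norm h0).
  have := ler_wpM2l (normr_ge0 lam) (ltW h1).
  move=> /le_trans; apply.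
  rewrite invfM mulrCA ler_piMr ?invr_ge0// ler_pdivrMr// mul1r lerDl//.
have := expR_tangent u2.
have -> : - lam - h^-1 * (expR (- (lam * h)) - 1) =
    - (h^-1 * (expR (- (lam * h)) - 1 + lam * h)).
  by field; rewrite gt_eqF.
rewrite normrN normrM gtr0_norm ?invr_gt0// => h3.
rewrite ler_pdivrMl// (le_trans h3)//.
have -> : 2 * (lam * h) ^+ 2 = h * (h * (2 * lam ^+ 2)) by ring.
rewrite ler_wpM2l ?(ltW h0)//.
have := ler_wpM2r (ltW q0) (ltW h2); rewrite mulfVK ?gt_eqF//; apply: le_trans.
by rewrite ler_wpM2l ?(ltW h0)// lerDl.
Qed.

Lemma rescale_generator lam T z a : generator T z a ->
  generator (rescale lam T) z (a - lam *: z).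
Proof.
move=> g; rewrite addrC -scaleNr.
have : (h^-1 * (expR (- (lam * h)) - 1)) *: z +
    expR (- (lam * h)) *: (h^-1 *: (T h z - z)) @[h --> 0^'+] --> - lam *: z + 1 *: a.
  apply: cvgD; last by apply: cvgZ; [exact: expRN_cvg1|exact: g].
  by apply: cvgZr_tmp; exact: expRN_diff.
rewrite scale1r; apply: cvg_trans; apply: near_eq_cvg; apply: nearW => h.
rewrite /rescale scalerA (mulrC (expR _)) -!scalerA -scalerDr; congr (_ *: _).
by rewrite scalerBr scalerBl scale1r [LHS]addrC addrA subrK.
Qed.

Lemma rescale_C0 lam T : C0_semigroup T -> C0_semigroup (rescale lam T).
Proof.
move=> [Tl [Tb [T0 [Ts Tc]]]]; split; [|split; [|split; [|split]]].
- by move=> t a x y t0; rewrite /rescale Tl// scalerDr !scalerA mulrC.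
- move=> t t0; have [M hM] := Tb t t0; exists (expR (- (lam * t)) * M) => x.
  by rewrite normrZ gtr0_norm ?expR_gt0// -mulrA ler_wpM2l ?expR_ge0.
- by move=> x; rewrite /rescale mulr0 oppr0 expR0 scale1r T0.
- move=> r t x r0 t0; rewrite /rescale Ts// (linZ (fun a x y => Tl r a x y r0)) scalerA.
  by rewrite -expRD mulrDr opprD.
- move=> x; rewrite /rescale -[X in _ --> X]scale1r.
  by apply: cvgZ; [exact: expRN_cvg1|exact: Tc].
Qed.

Section Generator.
Variables (T : R -> H -> H) (K w : R).
Hypotheses (hT : C0_semigroup T) (Tb : exp_bounded K w T) (w0 : 0 < w) (K0 : 0 <= K).

Lemma sg_lin t : 0 <= t -> lin (T t).
Proof. by move=> t0 a x y; have [h _] := hT; exact: h. Qed.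

Lemma sg0 x : T 0 x = x.
Proof. by have [_ [_ [h _]]] := hT. Qed.

Lemma sgD r t x : 0 <= r -> 0 <= t -> T (r + t) x = T r (T t x).
Proof. by have [_ [_ [_ [h _]]]] := hT; exact: h. Qed.

Lemma sg_cont x e : 0 < e ->
  exists2 d, 0 < d & forall r, 0 <= r < d -> `|T r x - x| <= e.
Proof.
move=> e0; have [_ [_ [_ [_ h]]]] := hT.
have := h x => /cvgrPdist_le /(_ _ e0) /near0r[d d0 hd]; exists d => // r.
case/andP; rewrite le_eqVlt => /orP[/eqP <- _|r0 rd].
  by rewrite sg0 subrr normr0 ltW.
by rewrite distrC hd// r0.
Qed.

Lemma sg_norm t x : 0 <= t -> `|T t x| <= K * `|x|.
Proof.
move=> t0; apply: (le_trans (Tb x t0)).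
by rewrite ler_wpM2r// -[leRHS]mulr1 ler_wpM2l// -expR0 ler_expR oppr_le0 mulr_ge0// ltW.
Qed.

Lemma gen_lin k z a z' a' : generator T z a -> generator T z' a' ->
  generator T (k *: z + z') (k *: a + a').
Proof.
move=> g g'; rewrite /generator.
have gk : k *: (h^-1 *: (T h z - z)) @[h --> 0^'+] --> k *: a by exact: cvgZl_tmp.
have : k *: (h^-1 *: (T h z - z)) + h^-1 *: (T h z' - z') @[h --> 0^'+] --> k *: a + a'.
  exact: cvgD.
apply: cvg_trans; apply: near_eq_cvg; apply/near0r; exists 1 => // h /andP[h0 _].
rewrite (sg_lin (ltW h0)) !scalerA mulrC -scalerA -scalerDr; congr (_ *: _).
by rewrite scalerBr opprD addrACA.
Qed.

Lemma gen_sg z a t : 0 <= t -> generator T z a -> generator T (T t z) (T t a).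
Proof.
move=> t0 /generatorP g; apply/generatorP => e e0.
have [_ [/(_ _ t0)[M hM] _]] := hT.
have M0 : 0 <= `|M| by [].
have [d d0 hd] := g (e / (`|M| + 1)) (divr_gt0 e0 (ltr_wpDl M0 ltr01)).
exists d => // h hh; have h0 : 0 <= h by case/andP: hh => /ltW.
have -> : T h (T t z) = T t (T h z) by rewrite -sgD// (addrC h) sgD.
rewrite -(linB (sg_lin t0)) -(linZ (sg_lin t0)) -(linB (sg_lin t0)).
rewrite (le_trans (hM _))// (le_trans (ler_wpM2r _ (ler_norm M)))//.
by rewrite (le_trans (ler_wpM2l _ (hd _ hh)))// mulrC ratio_le// ltW.
Qed.

End Generator.
End Semigroups.
(** * Resolvents of exponentially stable semigroups *)

Section HilleYosida.
Variables (R : realType) (H : completeNormedModType R).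
Variables (T : R -> H -> H) (K w : R).
Hypotheses (hT : C0_semigroup T) (Tb : exp_bounded K w T) (w0 : 0 < w) (K0 : 0 <= K).
Let Tl := sg_lin hT.

(* An equivalent norm for which T(t) has norm at most e^{-wt}. *)
Definition sgnorm (x : H) : R := sup [set expR (w * t) * `|T t x| | t in [set t | 0 <= t]].

Lemma sgnorm_ub x t : 0 <= t -> expR (w * t) * `|T t x| <= K * `|x|.
Proof.
move=> t0; apply: le_trans (ler_wpM2l (expR_ge0 _) (Tb x t0)) _.
by rewrite expRN mulrA mulrCA divff ?mulr1// gt_eqF// expR_gt0.
Qed.

Lemma sgnorm_has_sup x : has_sup [set expR (w * t) * `|T t x| | t in [set t | 0 <= t]].
Proof.
split; first by exists (expR (w * 0) * `|T 0 x|), 0 => //=.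
by exists (K * `|x|) => _ [t /= t0 <-]; exact: sgnorm_ub.
Qed.

Lemma sgnorm_ge x t : 0 <= t -> expR (w * t) * `|T t x| <= sgnorm x.
Proof.
by move=> t0; apply: ub_le_sup; [case: (sgnorm_has_sup x)|exists t].
Qed.

Lemma sgnorm_le x M : (forall t, 0 <= t -> expR (w * t) * `|T t x| <= M) ->
  sgnorm x <= M.
Proof.
move=> h; apply: ge_sup; first by case: (sgnorm_has_sup x).
by move=> _ [t /= t0 <-]; exact: h.
Qed.

Lemma le_sgnorm x : `|x| <= sgnorm x.
Proof. by have := sgnorm_ge x (lexx 0); rewrite mulr0 expR0 mul1r (sg0 hT). Qed.

Lemma sgnorm_le_norm x : sgnorm x <= K * `|x|.
Proof. by apply: sgnorm_le => t; exact: sgnorm_ub. Qed.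

Lemma sgnormD x y : sgnorm (x + y) <= sgnorm x + sgnorm y.
Proof.
apply: sgnorm_le => t t0; rewrite (linD (Tl t0)).
rewrite (le_trans (ler_wpM2l (expR_ge0 _) (ler_normD _ _)))// mulrDr.
by rewrite lerD// sgnorm_ge.
Qed.

Lemma sgnormZ c x : 0 <= c -> sgnorm (c *: x) <= c * sgnorm x.
Proof.
move=> c0; apply: sgnorm_le => t t0; rewrite (linZ (Tl t0)) normrZ ger0_norm//.
by rewrite mulrCA ler_wpM2l// sgnorm_ge.
Qed.

Lemma sgnorm_sg x d : 0 <= d -> sgnorm (T d x) <= expR (- (w * d)) * sgnorm x.
Proof.
move=> d0; apply: sgnorm_le => t t0; rewrite -(sgD hT)//.
rewrite (_ : w * t = - (w * d) + w * (t + d)); last by ring.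
by rewrite expRD -mulrA ler_wpM2l ?expR_ge0// sgnorm_ge// addr_ge0.
Qed.

(** For d > 0, (1 + d / h) z = T(d) z + (d / h) x - d q with q tending to 0, and T(d) contracts
    [sgnorm] by e^{-wd}; dividing by d and letting d tend to 0 gives the bound. In this norm it can
    be iterated without accumulating powers of K. *)
Lemma dissipative z a h : 0 < h -> generator T z a ->
  (1 + w * h) * sgnorm z <= sgnorm (z - h *: a).
Proof.
move=> h0 /generatorP g; set x := z - h *: a.
have n0 : 0 <= sgnorm z by rewrite (le_trans _ (le_sgnorm z)).
have h1 : h != 0 by rewrite gt_eqF.
rewrite -(ler_pM2l (_ : 0 < h^-1)) ?invr_gt0//.
apply: (@small_le0 _ _ _ (K + w ^+ 2 * sgnorm z)) => [|e e0].
  by rewrite addr_ge0// mulr_ge0// sqr_ge0.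
have [d1 d10 hd1] := g _ e0.
pose d := Num.min (d1 / 2) e.
have d0 : 0 < d by rewrite lt_min divr_gt0.
have dd1 : d < d1 by rewrite gt_min; apply/orP; left; lra.
have de : d <= e by rewrite ge_min lexx orbT.
have dn : d != 0 by rewrite gt_eqF.
have {}hd1 := hd1 d; rewrite d0 dd1 in hd1; have {}hd1 := hd1 isT.
set q := d^-1 *: (T d z - z) - a in hd1.
have dec : (1 + d / h) *: z = T d z + ((d / h) *: x + d *: (- q)).
  rewrite /q /x opprB !scalerBr !scalerA mulfVK// mulfV// -scalerBr scale1r.
  rewrite [_ - _ + (_ - _)]addrA subrK opprB addrCA [T d z + _]addrCA subrr addr0.
  by rewrite scalerDl scale1r addrC.
have dh0 : 0 <= d / h by rewrite divr_ge0 ?(ltW h0) ?(ltW d0).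
have ndec : (1 + d / h) * sgnorm z <= sgnorm ((1 + d / h) *: z).
  have p : 0 < 1 + d / h by rewrite ltr_wpDr.
  rewrite -[X in _ * sgnorm X](scalerK (lt0r_neq0 p)).
  rewrite -(ler_pM2l (_ : 0 < (1 + d / h)^-1)) ?invr_gt0// mulKf ?gt_eqF//.
  by rewrite sgnormZ// invr_ge0 ltW.
have b1 : sgnorm ((1 + d / h) *: z) <=
    (1 + w * d)^-1 * sgnorm z + (d / h * sgnorm x + d * (K * e)).
  rewrite dec; apply: le_trans (sgnormD _ _) _; apply: lerD.
    apply: le_trans (sgnorm_sg _ (ltW d0)) _; rewrite ler_wpM2r// expRN_le//.
    by rewrite mulr_ge0// ltW.
  apply: le_trans (sgnormD _ _) _; apply: lerD; first exact: sgnormZ.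
  apply: le_trans (sgnormZ _ (ltW d0)) _; rewrite ler_wpM2l ?(ltW d0)//.
  by apply: le_trans (sgnorm_le_norm _) _; rewrite ler_wpM2l// normrN.
have b2 : (1 + w * d)^-1 <= 1 - w * d + w ^+ 2 * d ^+ 2.
  have wd : 0 <= w * d by rewrite mulr_ge0 ?(ltW w0) ?(ltW d0).
  rewrite -[leLHS]mul1r ler_pdivrMr; last by lra.
  have := exprn_ge0 3 wd; rewrite !exprS expr0; lra.
have b3 := ler_wpM2r n0 b2.
have b4 : w ^+ 2 * sgnorm z * d <= w ^+ 2 * sgnorm z * e.
  by rewrite ler_wpM2l// mulr_ge0// sqr_ge0.
rewrite -(ler_pM2l d0).
have h2 : h^-1 * (1 + w * h) = h^-1 + w by field.
rewrite [h^-1 * (_ * _)]mulrA h2.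
move: (le_trans ndec b1) b3 (ler_wpM2l (ltW d0) b4).
move: (sgnorm z) (sgnorm x) h^-1 (1 + w * d)^-1 => n m i j c1 c2 c3.
lra.
Qed.

Lemma generator_inj z z' a a' h : 0 < h -> generator T z a -> generator T z' a' ->
  z - h *: a = z' - h *: a' -> z = z'.
Proof.
move=> h0 g g' e; have gd := gen_lin (k := -1) hT g' g.
have wh : 0 < 1 + w * h by rewrite addr_gt0// mulr_gt0.
have := dissipative h0 gd.
rewrite !scaleN1r => h1.
have e0 : - z' + z - h *: (- a' + a) = 0.
  rewrite scalerDr scalerN opprD opprK addrACA addrC e.
  by rewrite [- z' + _]addrC -(opprB z') subrr.
rewrite e0 in h1.
have : sgnorm (- z' + z) <= 0.
  rewrite -(pmulr_rle0 _ wh); apply: le_trans h1 _.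
  by apply: le_trans (sgnorm_le_norm 0) _; rewrite normr0 mulr0.
move=> /(le_trans (le_sgnorm _)); rewrite normr_le0 addrC subr_eq0 => /eqP //.
Qed.

(* Riemann sums of int_0^{d J} T(t) y dt; their limit is - A^{-1} y. *)
Definition rsum (d : R) (J : nat) (y : H) : H := d *: \sum_(j < J) T (d * j%:R) y.

Lemma rsumS d J y : rsum d J.+1 y = rsum d J y + d *: T (d * J%:R) y.
Proof. by rewrite /rsum big_ord_recr scalerDr. Qed.

Lemma rsum_lin d J : 0 <= d -> lin (rsum d J).
Proof.
move=> d0 a x y; elim: J => [|J IH].
  by rewrite /rsum !big_ord0 !scaler0 addr0.
rewrite !rsumS IH (Tl (mulr_ge0 d0 (ler0n R J))) scalerDr scalerDr addrACA.
by rewrite !scalerA (mulrC d).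
Qed.

Lemma rsumD d J J' y : 0 <= d ->
  rsum d (J + J') y = rsum d J y + T (d * J%:R) (rsum d J' y).
Proof.
move=> d0; have t0 j : 0 <= d * j%:R by rewrite mulr_ge0.
elim: J' => [|J' IH].
  by rewrite addn0 /rsum big_ord0 scaler0 (lin0 (Tl (t0 J))) addr0.
rewrite addnS !rsumS IH (linD (Tl (t0 J))) (linZ (Tl (t0 J)) d (T _ y)) -(sgD hT)// addrA.
by rewrite natrD mulrDr.
Qed.

(** A sum over a refined mesh is a sum over the coarse mesh applied to a local average of the orbit
    of y. Comparing two meshes thus reduces to comparing y with its average. *)
Lemma rsum_mul d J p y : 0 < d -> (0 < p)%N ->
  rsum d (J * p) y = rsum (d * p%:R) J ((d * p%:R)^-1 *: rsum d p y).
Proof.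
move=> d0 p0; have dp : d * p%:R != 0 by rewrite mulf_neq0 ?gt_eqF// ltr0n.
have t0 (k j : nat) : 0 <= d * k%:R * j%:R by rewrite !mulr_ge0// ltW.
elim: J => [|J IH]; first by rewrite mul0n /rsum !big_ord0 !scaler0.
rewrite mulSn addnC rsumD 1?ltW// IH rsumS; move: (rsum d p y) => v.
rewrite (linZ (Tl (t0 _ _)) _ v) scalerA mulfV// scale1r.
by rewrite natrM mulrA mulrAC.
Qed.

Let C := K * ((1 + w) / w).

(** A geometric series of ratio 1 / (1 + w d), bounded by (1 + w d) / w after multiplication by d;
    with d <= 1 this is uniform in the mesh and in J. *)
Lemma rsum_bound d J y : 0 < d <= 1 -> `|rsum d J y| <= C * `|y|.
Proof.
case/andP=> d0 d1; have wd : 0 < w * d by rewrite mulr_gt0.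
have r0 : 0 <= (1 + w * d)^-1 by rewrite invr_ge0 addr_ge0// ltW.
have geo : w * d * \sum_(j < J) (1 + w * d)^-1 ^+ j <= (1 + w * d) * (1 - (1 + w * d)^-1 ^+ J).
  elim: J => [|J IH]; first by rewrite big_ord0 expr0 subrr !mulr0.
  rewrite big_ord_recr /= mulrDr (le_trans (lerD IH (lexx _)))//.
  rewrite exprS mulrBr mulrBr mulrA mulfV ?gt_eqF ?addr_gt0//.
  move: (_ ^+ J) => q; lra.
have r1 : (1 + w * d)^-1 <= 1 by rewrite invf_le1 ?lerDl ?addr_gt0// ltW.
rewrite /rsum normrZ gtr0_norm//.
have : `|\sum_(j < J) T (d * j%:R) y| <= \sum_(j < J) K * (1 + w * d)^-1 ^+ j * `|y|.
  apply: le_trans (ler_norm_sum _ _ _) _; apply: ler_sum => j _.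
  apply: le_trans (Tb y (mulr_ge0 (ltW d0) (ler0n _ _))) _.
  rewrite ler_wpM2r// ler_wpM2l//.
  rewrite (_ : - (w * (d * j%:R)) = j%:R * - (w * d)) ?expRM_natl; last by ring.
  by rewrite lerXn2r ?nnegrE ?expR_ge0// expRN_le// ltW.
move=> /(ler_wpM2l (ltW d0)) /le_trans; apply.
rewrite -mulr_suml -mulr_sumr mulrA ler_wpM2r// mulrCA /C ler_wpM2l//.
rewrite ler_pdivlMr// mulrC mulrA; apply: le_trans geo _.
apply: (@le_trans _ _ (1 + w * d)); last by rewrite lerD2l ler_piMr// ltW.
by rewrite ler_piMr ?addr_ge0 ?(ltW wd)// lerBlDr lerDl exprn_ge0.
Qed.

Lemma rsum_near d p y e : 0 < d -> 
  (forall r, 0 <= r <= d * p%:R -> `|T r y - y| <= e) ->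
  `|rsum d p y - (d * p%:R) *: y| <= d * p%:R * e.
Proof.
move=> d0 h.
have -> : rsum d p y - (d * p%:R) *: y = d *: \sum_(j < p) (T (d * j%:R) y - y).
  rewrite /rsum -scalerA -scalerBr sumrB; congr (_ *: (_ - _)).
  by rewrite sumr_const card_ord scaler_nat.
rewrite normrZ gtr0_norm// -mulrA ler_wpM2l ?(ltW d0)//.
apply: le_trans (ler_norm_sum _ _ _) _.
rewrite mulr_natl -[X in _ *+ X](card_ord p) -sumr_const; apply: ler_sum => j _.
apply: h; rewrite mulr_ge0 ?(ltW d0)//= ler_wpM2l ?(ltW d0)// ler_nat ltnW//.
Qed.

End HilleYosida.

(** * Inverting the generator by dyadic Riemann sums *)

Section Surjectivity.
Variables (R : realType) (H : completeNormedModType R).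
Variables (T : R -> H -> H) (K w : R).
Hypotheses (hT : C0_semigroup T) (Tb : exp_bounded K w T) (w0 : 0 < w) (K0 : 0 <= K).
Let Tl := sg_lin hT.
Let Tn := sg_norm Tb w0 K0.
Let C := K * ((1 + w) / w).
(** With 4^k nodes, the mesh 2^-k reaches time 2^k: the mesh is refined and the interval extended
    together, each mesh dividing the previous ones. *)
Let d k : R := (2 ^+ k)^-1.

Let C0 : 0 <= C.
Proof. by rewrite mulr_ge0// divr_ge0 ?addr_ge0// ltW. Qed.

Let d0 k : 0 < d k.
Proof. by rewrite invr_gt0 exprn_gt0. Qed.

Let d1 k : d k <= 1.
Proof. by rewrite invf_le1 ?exprn_gt0// exprn_ege1// ler1n. Qed.

Let dle k : d k <= k.+1%:R^-1.
Proof.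
rewrite lef_pV2 ?posrE ?exprn_gt0// -natrX ler_nat.
exact: ltn_expl.
Qed.

Let dD k i : d (k + i) * (2 ^ i)%:R = d k.
Proof. by rewrite /d natrX exprD invfM mulfVK// expf_neq0. Qed.

Let dJ k : d k * (4 ^ k)%:R = 2 ^+ k.
Proof.
rewrite /d natrX (_ : 4 = 2 * 2 :> R) ?exprMn ?mulKf ?expf_neq0//; ring.
Qed.

Lemma scaler_invB (c : R) (v u : H) : 0 < c ->
  c^-1 *: v - u = c^-1 *: (v - c *: u).
Proof. by move=> c0; rewrite scalerBr scalerA mulVf ?gt_eqF// scale1r. Qed.

Lemma exp_tail e : 0 < e -> exists N, forall k, (N <= k)%N -> expR (- (w * 2 ^+ k)) <= e.
Proof.
move=> e0; have [N hN] := inv_small (mulr_gt0 e0 w0); exists N => k /hN h.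
have p : 0 < (2 : R) ^+ k by rewrite exprn_gt0.
apply: le_trans (expRN_le _) _; first by rewrite mulr_ge0 ?ltW.
rewrite -[leLHS]mul1r ler_pdivrMr ?addr_gt0 ?mulr_gt0//.
have : (2 ^+ k)^-1 <= e * w by apply: le_trans (dle k) (ltW h).
rewrite -[leLHS]mul1r ler_pdivrMr// => h2.
by rewrite mulrDr mulr1 ler_wpDl// ?mulrA// ltW.
Qed.

Lemma rsum_cauchy y : exists xl : H,
  rsum T (d k) (4 ^ k) y @[k --> \oo] --> xl.
Proof.
set x := fun k => rsum T (d k) (4 ^ k) y.
(* The finer sum is cut at time 2^k. Up to there [rsum_mul] compares it with the coarse sum; the
   rest carries a factor T(2^k) and decays. *)
have key k i e : (forall r, 0 <= r <= d k -> `|T r y - y| <= e) ->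
    `|x (k + i)%N - x k| <= C * e + K * expR (- (w * 2 ^+ k)) * (C * `|y|).
  move=> he; set m := (k + i)%N.
  have Jle : (4 ^ k * 2 ^ i <= 4 ^ m)%N by rewrite /m expnD leq_pmul2l ?expn_gt0// (expnMn 2 2) leq_pmulr// expn_gt0.
  have tm : d m * (4 ^ k * 2 ^ i)%:R = 2 ^+ k.
    by rewrite natrM mulrCA mulrC dD dJ.
  rewrite /x -(subnKC Jle) (rsumD hT) ?(ltW (d0 _))// tm.
  rewrite (rsum_mul hT)// ?expn_gt0// dD addrAC.
  apply: le_trans (ler_normD _ _) _; apply: lerD; last first.
    apply: le_trans (Tb _ _) _; first by rewrite exprn_ge0.
    by rewrite ler_wpM2l ?mulr_ge0 ?expR_ge0// (rsum_bound Tb)// d0 d1.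
  rewrite -(linB (rsum_lin hT _ (ltW (d0 k)))).
  apply: le_trans (rsum_bound Tb w0 K0 _ _ _) _; first by rewrite d0 d1.
  rewrite -/C ler_wpM2l//.
  have h := @rsum_near _ _ T (d m) (2 ^ i) y e (d0 m); rewrite dD in h.
  have {}h := h he.
  by rewrite (scaler_invB _ _ (d0 k)) normrZ gtr0_norm ?invr_gt0// ler_pdivrMl.
suff : cvgn x by move=> cx; exists (limn x).
apply: cauchy_seq_cvg => e e0.
have [N hN] : exists N, forall k, (N <= k)%N -> forall i, `|x (k + i)%N - x k| <= e / 4.
  pose q := e / 8 / (C + 1).
  have q0 : 0 < q by rewrite !divr_gt0// ltr_wpDl.
  have [eta eta0 heta] := sg_cont hT y q0.
  have KC : 0 <= K * (C * `|y|) by rewrite mulr_ge0// mulr_ge0.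
  have r0 : 0 < e / 8 / (K * (C * `|y|) + 1) by rewrite !divr_gt0// ltr_wpDl.
  have [N1 hN1] := exp_tail r0.
  have [N2 hN2] := inv_small eta0.
  exists (maxn N1 N2) => k; rewrite geq_max => /andP[k1 k2] i.
  apply: le_trans (key k i q _) _.
    move=> r /andP[r1 r2]; apply: heta; rewrite r1 /=.
    by rewrite (le_lt_trans r2)// (le_lt_trans (dle k))// hN2.
  have h1 : C * q <= e / 8 by rewrite mulrC ratio_le// ltW// divr_gt0.
  have h2 : K * expR (- (w * 2 ^+ k)) * (C * `|y|) <= e / 8.
    rewrite mulrAC (mulrC _ (expR _)); apply: le_trans (ler_wpM2r KC (hN1 _ k1)) _.
    by rewrite ratio_le// ltW// divr_gt0.
  by move: (lerD h1 h2); move: (C * q) => u; move: (K * _ * _) => v; lra.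
exists N => n k nN kN.
have h1 := hN N (leqnn N) (n - N)%N; have h2 := hN N (leqnn N) (k - N)%N.
rewrite !subnKC// in h1 h2.
have -> : x n - x k = (x n - x N) - (x k - x N) by rewrite opprB addrA subrK.
apply: le_lt_trans (ler_normB _ _) _.
by move: h1 h2; move: `|x n - x N| `|x k - x N| => u v h1 h2; lra.
Qed.

(** Approximation from above, so that a dyadic time is h plus a nonnegative increment and the
    semigroup law applies. *)
Lemma dyadic_above (h s : R) : 0 <= h -> 0 < s ->
  exists p i, h < d i * p%:R <= h + s.
Proof.
move=> h0 s0; have [i hi] := inv_small s0.
have di : d i < s by rewrite (le_lt_trans (dle i))// hi.
have p0 : 0 <= h * 2 ^+ i by rewrite mulr_ge0// exprn_ge0.
exists (Num.truncn (h * 2 ^+ i)).+1, i.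
have /andP[t1 t2] := truncn_itv p0.
have q : 0 < (2 : R) ^+ i by rewrite exprn_gt0.
apply/andP; split.
  by rewrite mulrC ltr_pdivlMr.
rewrite -natr1 mulrDr mulr1; apply: lerD (ltW di).
by rewrite mulrC ler_pdivrMr.
Qed.

Lemma generator_surj y : exists x, generator T x y.
Proof.
(* The integral of T(t) y over the half-line is -A^{-1} y, hence the sign. *)
have [xl cx] := rsum_cauchy (- y); exists xl.
set x := fun k => rsum T (d k) (4 ^ k) (- y) in cx.
have dyad p i e : (forall r, 0 <= r <= d i * p%:R -> `|T r (- y) - - y| <= e) ->
    `|T (d i * p%:R) xl - xl - (d i * p%:R) *: y| <= d i * p%:R * e.
  set h := d i * p%:R => he.
  have h0 : 0 <= h by rewrite mulr_ge0// ltW.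
  apply: (@small_le0 _ _ _ (K * (C * `|y|) + K + 1)).
    by rewrite !addr_ge0// mulr_ge0// mulr_ge0.
  move=> s s0; have [N1 hN1] := exp_tail s0.
  move/cvgrPdist_le: cx => /(_ _ s0)[N2 _ hN2].
  pose k := maxn (maxn N1 N2) i.
  have k1 : (N1 <= k)%N by rewrite /k !leq_max leqnn.
  have k2 : (N2 <= k)%N by rewrite /k !leq_max leqnn orbT.
  have ki : (i <= k)%N by rewrite /k leq_max leqnn orbT.
  pose q := (p * 2 ^ (k - i))%N.
  have hq : d k * q%:R = h.
    by rewrite /q mulnC natrM mulrA -{1}(subnKC ki) dD.
  (* The sum over q + 4^k nodes is split in two ways, after q and after 4^k nodes. This is exact
     because h is a multiple of the mesh; the first term decays and the second is close to h y. *)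
  have e1 : T h (x k) - x k = T (2 ^+ k) (rsum T (d k) q (- y)) - rsum T (d k) q (- y).
    have a1 := rsumD hT q (4 ^ k) (- y) (ltW (d0 k)).
    have a2 := rsumD hT (4 ^ k) q (- y) (ltW (d0 k)).
    rewrite addnC a1 hq dJ -/(x k) in a2.
    apply/eqP; rewrite subr_eq addrAC eq_sym subr_eq.
    by rewrite addrC -a2 addrC.
  have b1 : `|T h (x k) - x k - h *: y| <= K * s * (C * `|y|) + h * e.
    rewrite e1 -addrA; apply: le_trans (ler_normD _ _) _; apply: lerD.
      apply: le_trans (Tb _ _) _; first by rewrite exprn_ge0.
      apply: ler_pM; rewrite ?mulr_ge0 ?expR_ge0//.
        by rewrite ler_wpM2l// hN1.
      by rewrite -(normrN y) (rsum_bound Tb)// d0 d1.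
    rewrite -opprD normrN -[X in _ + X]opprK -scalerN -hq.
    by apply: rsum_near => //; rewrite hq.
  have b2 : `|T h xl - T h (x k)| <= K * s.
    rewrite -(linB (Tl h0)); apply: le_trans (Tn _ h0) _.
    by rewrite ler_wpM2l// hN2.
  have b3 : `|x k - xl| <= s by rewrite distrC hN2.
  have -> : T h xl - xl - h *: y = (T h xl - T h (x k)) + (T h (x k) - x k - h *: y) + (x k - xl).
    rewrite -!addrA; rewrite addKr; congr (_ + _).
    by rewrite addrCA addKr addrC.
  apply: le_trans (ler_normD _ _) _; apply: le_trans (lerD (ler_normD _ _) b3) _.
  move: (lerD b2 b1); move: `|_ - _| `|_ - _ - _| (C * `|y|) => n1 n2 c hh; lra.
apply/generatorP => e e0.
have [eta eta0 heta] := sg_cont hT (- y) e0.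
exists eta => // h /andP[h0 h1].
rewrite (scaler_invB _ _ h0) normrZ gtr0_norm ?invr_gt0// ler_pdivrMl//.
apply: (@small_le0 _ _ _ (K + `|y| + e)); first by rewrite !addr_ge0// ltW.
move=> s s0; have [eta2 eta20 heta2] := sg_cont hT xl s0.
(* An arbitrary h is reached from a dyadic h' > h that is still below eta and within eta2 of h. *)
pose s2 := Num.min s (Num.min (eta2 / 2) ((eta - h) / 2)).
have s20 : 0 < s2 by rewrite !lt_min s0 !divr_gt0// subr_gt0.
have [p [i /andP[]]] := dyadic_above (ltW h0) s20.
have := @dyad p i e; set h' := d i * p%:R => dy hh1 hh2.
have s2s : s2 <= s by rewrite /s2 ge_min lexx.
have s2e : s2 <= eta2 / 2 by rewrite /s2 !ge_min lexx orbT.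
have s2h : s2 <= (eta - h) / 2 by rewrite /s2 !ge_min lexx !orbT.
have {}dy : `|T h' xl - xl - h' *: y| <= h' * e.
  by apply: dy => r /andP[r0 r1]; apply: heta; rewrite r0 /=; lra.
have hd0 : 0 <= h' - h by lra.
have b1 : `|T h xl - T h' xl| <= K * s.
  have -> : T h' xl = T h (T (h' - h) xl) by rewrite -(sgD hT) ?(ltW h0)// addrC subrK.
  rewrite distrC -(linB (Tl (ltW h0))); apply: le_trans (Tn _ (ltW h0)) _.
  by rewrite ler_wpM2l// heta2// hd0 /=; lra.
have b2 : `|(h' - h) *: y| <= s * `|y|.
  by rewrite normrZ ger0_norm// ler_wpM2r//; lra.
have -> : T h xl - xl - h *: y = (T h xl - T h' xl) + (T h' xl - xl - h' *: y) + (h' - h) *: y.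
  by rewrite scalerBl -!addrA !addKr.
apply: le_trans (ler_normD _ _) _; apply: le_trans (lerD (ler_normD _ _) b2) _.
have b3 : h' * e <= (h + s) * e by rewrite ler_wpM2r ?(ltW e0)//; lra.
move: (lerD b1 dy); move: `|_ - _| `|_ - _ - _| `|y| => n1 n2 c hh; lra.
Qed.

End Surjectivity.

Section Resolvent.
Variables (R : realType) (H : completeNormedModType R).

(** Solving (I - h A) z = u means solving (A - 1/h) z = - u / h, which is surjectivity for the
    rescaled semigroup. Iterating [dissipative] bounds the powers, and [sgnorm] is left only at the
    end, at the price of one K. *)
Lemma generator_resolvents (T : R -> H -> H) K w : C0_semigroup T ->
  exp_bounded K w T -> 0 < w -> 0 <= K -> resolvents K w (generator T).
Proof.
move=> hT Tb w0 K0 h h0.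
have hn : h != 0 by rewrite gt_eqF.
have ex u : exists z, generator T z (h^-1 *: (z - u)).
  have wh : 0 < w + h^-1 by rewrite addr_gt0// invr_gt0.
  have [z hz] := generator_surj (rescale_C0 h^-1 hT) (rescale_bounded h^-1 Tb) wh K0 (- (h^-1 *: u)).
  have := rescale_generator (lam := - h^-1) hz; rewrite rescaleK => g; exists z.
  by move: g; rewrite scaleNr opprK addrC -scalerBr.
have [E hE] := choice ex.
have sol u : E u - h *: (h^-1 *: (E u - u)) = u.
  by rewrite scalerA mulfV// scale1r opprB addrCA subrr addr0.
have inj z a u : generator T z a -> z - h *: a = u -> E u = z.
  move=> g e; apply: (generator_inj hT Tb w0 K0 h0 (hE u) g).
  by rewrite sol e.
exists E; split => //.
- move=> c x y; apply: (inj _ _ _ (gen_lin hT (hE x) (hE y))).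
  rewrite scalerDr opprD addrACA sol; congr (_ + _).
  by rewrite [h *: _]scalerA mulrC -scalerA -scalerBr sol.
- by move=> z a g; exact: inj g _.
- move=> j x.
  have wh : 0 < 1 + w * h by rewrite addr_gt0// mulr_gt0.
  have one u : sgnorm T w (E u) <= (1 + w * h)^-1 * sgnorm T w u.
    by rewrite ler_pdivlMl//; have := dissipative hT Tb w0 K0 h0 (hE u); rewrite sol.
  apply: le_trans (le_sgnorm hT Tb _) _.
  rewrite mulrAC mulrC; apply: le_trans (_ : (1 + w * h)^-1 ^+ j * sgnorm T w x <= _); last first.
    by rewrite ler_wpM2l ?exprn_ge0 ?invr_ge0 ?(ltW wh)// (sgnorm_le_norm Tb).
  elim: j => [|j IH]; first by rewrite expr0 mul1r.
  rewrite iterS exprS -mulrA; apply: le_trans (one _) _.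
  by rewrite ler_wpM2l// invr_ge0 ltW.
Qed.

End Resolvent.
(** * Integrals over the half-line *)

Section ImproperIntegral.
Variable R : realType.
Notation mu := (@lebesgue_measure R).

(** Only positive times are considered, since t^(alpha - 1) is singular at 0. *)
Definition pcont (f : R -> R) := forall t : R, 0 < t -> {for t, continuous f}.
Definition pderiv (F f : R -> R) := forall t : R, 0 < t -> is_derive t 1 F (f t).

Lemma pcont_within f a b : 0 < a -> pcont f -> {within `[a, b], continuous f}.
Proof.
move=> a0 cf; apply: continuous_in_subspaceT => t; rewrite inE /= in_itv /=.
by move=> /andP[at_ _]; apply: cf; exact: lt_le_trans at_.
Qed.

Lemma pcont_integrable f a b : 0 < a -> pcont f -> mu.-integrable `[a, b] (EFin \o f).
Proof.
move=> a0 cf; apply: continuous_compact_integrable; first exact: segment_compact.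
exact: pcont_within.
Qed.

Lemma pcontD f g : pcont f -> pcont g -> pcont (fun t => f t + g t).
Proof. by move=> cf cg t t0; apply: cvgD; [exact: cf|exact: cg]. Qed.

Lemma pcontM f g : pcont f -> pcont g -> pcont (fun t => f t * g t).
Proof. by move=> cf cg t t0; apply: cvgM; [exact: cf|exact: cg]. Qed.

Lemma pcont_cst c : pcont (fun=> c).
Proof. by move=> t t0; exact: cvg_cst. Qed.

Lemma pderiv_cont F f : pderiv F f -> pcont F.
Proof.
move=> dF t t0; apply: differentiable_continuous; apply/derivable1_diffP.
by have [] := dF t t0.
Qed.

Lemma FTC_Rintegral (F f : R -> R) a b : 0 < a -> a < b -> pderiv F f -> pcont f ->
  Rintegral mu `[a, b] f = F b - F a.
Proof.
move=> a0 ab dF cf; have cF := pderiv_cont dF.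
have b0 := lt_trans a0 ab.
rewrite /Rintegral (@continuous_FTC2 _ f F a b)//.
- exact: pcont_within.
- split.
  + move=> t; rewrite in_itv /= => /andP[at_ _].
    by have [] := dF t (lt_trans a0 at_).
  + by apply: cvg_at_right_filter; exact: cF.
  + by apply: cvg_at_left_filter; exact: cF.
- move=> t; rewrite in_itv /= => /andP[at_ _].
  by rewrite derive1E; have [_ ->] := dF t (lt_trans a0 at_).
Qed.

Lemma Rintegral_split f a c b : 0 < a -> a < c -> c < b -> pcont f ->
  Rintegral mu `[a, b] f = Rintegral mu `[a, c] f + Rintegral mu `[c, b] f.
Proof.
move=> a0 ac cb cf; have c0 := lt_trans a0 ac.
have := @Rintegral_itvB _ f (BLeft a) (BRight b) c (pcont_integrable _ a0 cf).
rewrite !bnd_simp => /(_ (ltW ac) (ltW cb)) h.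
rewrite [X in _ = _ + X](_ : _ = Rintegral mu `]c, b] f).
  by rewrite -h addrC subrK.
rewrite -Rintegral_itv_obnd_cbnd//.
apply: integrableS (pcont_integrable b c0 cf) => //.
by apply: subset_itvr; rewrite bnd_simp.
Qed.

Lemma Rintegral_le_split f c F1 f1 F2 f2 a b : pcont f ->
  pderiv F1 f1 -> pcont f1 -> pderiv F2 f2 -> pcont f2 ->
  0 < a -> a < c -> c < b ->
  (forall t, 0 < t <= c -> f t <= f1 t) -> (forall t, c <= t -> f t <= f2 t) ->
  Rintegral mu `[a, b] f <= (F1 c - F1 a) + (F2 b - F2 c).
Proof.
move=> cf d1 c1 d2 c2 a0 ac cb h1 h2; have c0 := lt_trans a0 ac.
rewrite (Rintegral_split a0 ac cb cf) -(FTC_Rintegral a0 ac d1 c1) -(FTC_Rintegral c0 cb d2 c2).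
apply: lerD; apply: le_Rintegral => //; try exact: pcont_integrable.
  by move=> t /=; rewrite in_itv /= => /andP[at_ tc]; apply: h1; rewrite tc (lt_le_trans a0).
by move=> t /=; rewrite in_itv /= => /andP[ct tb]; apply: h2.
Qed.

Lemma pos_measurable (f : R -> R) : pcont f -> measurable_fun (`](0 : R), +oo[ : set (measurableTypeR R)) f.
Proof.
move=> cf; apply: open_continuous_measurable_fun => //.
by move=> t; rewrite inE /= in_itv /= andbT => t0; exact: cf.
Qed.

Lemma ge0_improper (f : R -> R) c B : 0 < c -> pcont f -> (forall t, 0 < t -> 0 <= f t) ->
  (forall a b, 0 < a -> a < c -> c < b -> Rintegral mu `[a, b] f <= B) ->
  mu.-integrable `]0, +oo[ (EFin \o f) /\ Rintegral mu `]0, +oo[ f <= B.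
Proof.
move=> c0 cf f0 hB.
(* The index n + 2 exceeds 1, so c lies strictly inside every interval and [hB] applies; monotone
   convergence does the rest. *)
pose J (n : nat) : set (measurableTypeR R) := `[c / n.+2%:R, c * n.+2%:R]%classic.
have n0 (n : nat) : 0 < n.+2%:R :> R by [].
have n1 (n : nat) : 1 < n.+2%:R :> R by rewrite ltr1n.
have l0 n : 0 < c / n.+2%:R by rewrite divr_gt0.
have U : `]0, +oo[%classic = \bigcup_n J n.
  apply/seteqP; split=> [t /=|t [n _]]; rewrite /J /= !in_itv /= ?andbT.
    move=> t0; pose n := Num.truncn (t / c + c / t); exists n => //=.
    rewrite in_itv /=.
    have hn : t / c + c / t < n.+2%:R.
      by rewrite (lt_trans (truncnS_gt _))// ltr_nat.
    have tc : 0 < t / c by rewrite divr_gt0.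
    have ct : 0 < c / t by rewrite divr_gt0.
    apply/andP; split.
      rewrite ler_pdivrMr// mulrC -ler_pdivrMr//; lra.
    rewrite mulrC -ler_pdivrMr//; lra.
  by move=> /andP[ht _]; exact: lt_le_trans ht.
have JB n : (\int[mu]_(x in J n) (f x)%:E <= B%:E)%E.
  have := hB (c / n.+2%:R) (c * n.+2%:R) (l0 n).
  rewrite ltr_pdivrMr// ltr_pMr// => /(_ (n1 n) (n1 n)).
  rewrite -lee_fin /Rintegral fineK//.
  apply: integrable_fin_num => //; exact: pcont_integrable.
have mJ n : measurable_fun (J n) (EFin \o f).
  exact: (measurable_int mu (pcont_integrable _ (l0 n) cf)).
have f0J n x : J n x -> (0 <= (EFin \o f) x)%E.
  by rewrite /J /= in_itv /= lee_fin => /andP[h _]; apply: f0; exact: lt_le_trans h.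
have ndJ : nondecreasing_seq J.
  move=> m n mn; apply/subsetPset; apply: subset_itv; rewrite bnd_simp.
    by rewrite ler_pM2l// lef_pV2 ?posrE// ler_nat !ltnS.
  by rewrite ler_pM2l// ler_nat !ltnS.
have cvg : (\int[mu]_(x in J n) (f x)%:E)%E @[n --> \oo] -->
    (\int[mu]_(x in \bigcup_n J n) (f x)%:E)%E.
  apply: ge0_nondecreasing_set_cvg_integral => //.
  by move=> i; exact: measurable_itv.
rewrite -U in cvg.
have le : (\int[mu]_(x in `]0%R, +oo[) (f x)%:E <= B%:E)%E.
  by apply: (cvge_to_le cvg); apply: nearW => n; exact: JB.
have ge : (0 <= \int[mu]_(x in `]0%R, +oo[) (f x)%:E)%E.
  by apply: integral_ge0 => x /=; rewrite in_itv /= andbT lee_fin; exact: f0.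
split.
  apply/integrableP; split.
    by apply/measurable_EFinP; exact: pos_measurable.
  apply: le_lt_trans (ltry B); apply: le_trans le.
  rewrite le_eqVlt; apply/orP; left; apply/eqP; apply: eq_integral => x.
  by rewrite inE /= in_itv /= andbT => x0; rewrite ger0_norm// f0.
rewrite -lee_fin /Rintegral fineK// ge0_fin_numE//.
exact: le_lt_trans le (ltry B).
Qed.

(** [ge0_improper] is applied to the nonnegative function f + g and the integral of g is subtracted.
    [B0] serves integrability alone, so the one-sided bound [B] may exploit cancellation in f. *)
Lemma improper_le (f g : R -> R) c B B0 : 0 < c -> pcont f -> pcont g ->
  (forall t, 0 < t -> `|f t| <= g t) ->
  (forall a b, 0 < a -> a < c -> c < b -> Rintegral mu `[a, b] g <= B0) ->
  (forall a b, 0 < a -> a < c -> c < b -> Rintegral mu `[a, b] f <= B) ->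
  Rintegral mu `]0, +oo[ f <= B.
Proof.
move=> c0 cf cg fg hg hf.
have g0 t : 0 < t -> 0 <= g t by move=> /fg; apply: le_trans.
have [ig _] := ge0_improper c0 cg g0 hg.
have if_ : mu.-integrable `]0, +oo[ (EFin \o f).
  apply: le_integrable ig => //; first by apply/measurable_EFinP; exact: pos_measurable.
  move=> x; rewrite /= in_itv /= andbT lee_fin => x0.
  by rewrite (ger0_norm (g0 _ x0)) fg.
have [] := @ge0_improper (fun t => f t + g t) c (B + Rintegral mu `]0, +oo[ g) c0.
- exact: pcontD.
- by move=> t /fg; rewrite ler_norml => /andP[h _]; lra.
- move=> a b a0 ac cb; rewrite RintegralD ?pcont_integrable//.
  apply: lerD; first exact: hf.
  rewrite fine_le//.
  + by apply: integrable_fin_num => //; exact: pcont_integrable.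
  + exact: integrable_fin_num.
  + apply: ge0_subset_integral => //.
    * by apply/measurable_EFinP; exact: pos_measurable.
    * by move=> x /=; rewrite in_itv /= andbT lee_fin; exact: g0.
    * by move=> x /=; rewrite !in_itv /= andbT => /andP[h _]; exact: lt_le_trans h.
- by move=> _; rewrite RintegralD// lerD2r.
Qed.

End ImproperIntegral.
(** * Fractional powers *)

Section FractionalPowers.
Variables (R : realType) (H : completeNormedModType R).
Variables (ip : H -> H -> R) (hip : inner_product ip).
Variables (T : R -> H -> H) (K w : R).
Hypotheses (hT : C0_semigroup T) (Tb : exp_bounded K w T) (w0 : 0 < w) (K0 : 0 <= K).
Let bip := ip_bil hip.
Let Tl := sg_lin hT.
Let Tn := sg_norm Tb w0 K0.

Lemma orbit_cont_at (u : H) (t e : R) : 0 < t -> 0 < e -> exists2 d, 0 < d &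
  forall s, `|s - t| < d -> 0 <= s /\ `|T t u - T s u| <= e.
Proof.
move=> t0 e0; have e1 : 0 < e / (K + 1) by rewrite divr_gt0// ltr_wpDl.
have [d d0 hd] := sg_cont hT u e1.
exists (Num.min d t); first by rewrite lt_min d0.
have Ke : K * (e / (K + 1)) <= e by rewrite mulrC ratio_le// ltW.
move=> s; rewrite lt_min => /andP[sd st].
have s0 : 0 <= s by move: st; rewrite ltr_norml => /andP[h _]; lra.
split => //; have [ts|st'] := leP t s.
  have r0 : 0 <= s - t by rewrite subr_ge0.
  rewrite ger0_norm// in sd.
  have -> : T s u = T t (T (s - t) u) by rewrite -(sgD hT) ?(ltW t0)// addrC subrK.
  rewrite distrC -(linB (Tl (ltW t0))); apply: le_trans (Tn _ (ltW t0)) _.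
  by apply: le_trans Ke; rewrite ler_wpM2l// hd// r0.
have r0 : 0 <= t - s by rewrite subr_ge0 ltW.
rewrite distrC ger0_norm// in sd.
have -> : T t u = T s (T (t - s) u) by rewrite -(sgD hT)// addrC subrK.
rewrite -(linB (Tl s0)); apply: le_trans (Tn _ s0) _.
by apply: le_trans Ke; rewrite ler_wpM2l// hd// r0.
Qed.

Lemma orbit_pcont u v : pcont (fun t => ip (T t u) v).
Proof.
move=> t t0; apply: (cvg_ip hip); apply/cvgrPdist_le => e e0.
have [d d0 hd] := orbit_cont_at u t0 e0.
by exists d => //= s /=; rewrite distrC => /hd[].
Qed.

(** The generator supplies only right difference quotients at 0. For h < 0 the quotient at t is T(t
    + h) applied to a right quotient at 0, and continuity of the orbit of u replaces T(t + h) u by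
    T(t) u. *)
Lemma orbit_pderiv g u v : generator T g u ->
  pderiv (fun t => ip (T t g) v) (fun t => ip (T t u) v).
Proof.
move=> /generatorP gen t t0.
have lim : h^-1 *: (((fun t => ip (T t g) v) \o shift t) (h *: (1 : R)) - ip (T t g) v)
    @[h --> 0^'] --> ip (T t u) v.
  apply/cvgrPdist_le => e e0.
  pose q := e / 2 / ((K + 1) * `|v| + 1).
  have q0 : 0 < q by rewrite !divr_gt0// ltr_wpDl// mulr_ge0// addr_ge0.
  have qe : (K + 1) * q * `|v| <= e.
    rewrite mulrAC mulrC; apply: le_trans (ratio_le _ _) _.
    - by rewrite ltW// divr_gt0.
    - by rewrite mulr_ge0// addr_ge0.
    - lra.
  have [d1 d10 h1] := gen _ q0; have [d2 d20 h2] := orbit_cont_at u t0 q0.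
  exists (Num.min d1 (Num.min d2 t)); first by rewrite /= !lt_min d10 d20 t0.
  move=> h /=; rewrite sub0r normrN !lt_min => /andP[hd1 /andP[hd2 ht]] hn.
  rewrite /GRing.scale /= mulr1.
  have [h0|h0] := ltP 0 h.
    rewrite gtr0_norm// in hd1 hd2 ht.
    have -> : h^-1 * (ip (T (h + t) g) v - ip (T t g) v) = ip (T t (h^-1 *: (T h g - g))) v.
      rewrite (addrC h t) (sgD hT) ?(ltW t0) ?(ltW h0)// -(bilBl bip) -(linB (Tl (ltW t0))).
      by rewrite (linZ (Tl (ltW t0))) (bilZl bip).
    rewrite -(bilBl bip) -(linB (Tl (ltW t0))).
    apply: le_trans (ip_le hip _ _) _; apply: le_trans qe; rewrite ler_wpM2r//.
    apply: le_trans (Tn _ (ltW t0)) _; rewrite distrC.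
    apply: le_trans (_ : K * q <= _); last by rewrite ler_wpM2r ?(ltW q0)// lerDl.
    by rewrite ler_wpM2l// h1// h0.
  have hneg : h < 0 by rewrite lt_neqAle hn.
  have r0 : 0 < - h by rewrite oppr_gt0.
  rewrite ltr0_norm// in hd1 hd2 ht.
  have [s0 hs] : 0 <= h + t /\ `|T t u - T (h + t) u| <= q.
    by apply: h2; rewrite addrK ltr0_norm.
  have -> : h^-1 * (ip (T (h + t) g) v - ip (T t g) v) =
      ip (T (h + t) ((- h)^-1 *: (T (- h) g - g))) v.
    have -> : ip (T t g) v = ip (T (h + t) (T (- h) g)) v.
      by rewrite -(sgD hT) ?(ltW r0)// addrAC subrr add0r.
    rewrite -(bilBl bip) -(linB (Tl s0)) (linZ (Tl s0)) (bilZl bip).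
    by rewrite invrN mulNr -mulrN -(bilNl bip) -(linN (Tl s0)) opprB.
  rewrite -(bilBl bip).
  have -> : T t u - T (h + t) ((- h)^-1 *: (T (- h) g - g)) =
      (T t u - T (h + t) u) - T (h + t) ((- h)^-1 *: (T (- h) g - g) - u).
    by rewrite (linB (Tl s0)) opprB addrA subrK.
  apply: le_trans (ip_le hip _ _) _; apply: le_trans qe; rewrite ler_wpM2r//.
  apply: le_trans (ler_normB _ _) _; rewrite mulrDl mul1r addrC; apply: lerD => //.
  by apply: le_trans (Tn _ s0) _; rewrite ler_wpM2l// h1// r0.
by apply: DeriveDef; [exact: (cvgP _ lim)|exact: (cvg_lim _ lim)].
Qed.

Lemma powR_pderiv (a : R) : pderiv (fun t => t `^ a) (fun t => a * t `^ (a - 1)).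
Proof. by move=> t t0; exact: is_derive1_powR. Qed.

Lemma powR_neg_le (a c t : R) : a <= 0 -> 0 < c -> c <= t -> t `^ a <= c `^ a.
Proof.
move=> a0 c0 ct; rewrite -[a]opprK (powRN t (- a)) (powRN c (- a)) lef_pV2 ?posrE ?powR_gt0//.
  by apply: ge0_ler_powR; rewrite ?nnegrE ?oppr_ge0 ?(le_trans (ltW c0)) ?(ltW c0).
exact: lt_le_trans ct.
Qed.

(** On (0, del) the orbit of u is bounded. Beyond del, T(t) u is the derivative of T(t) g, and
    integration by parts replaces |u| by |g|, with boundary and interior terms each at most K |g|
    |v| del^(al - 1). *)
Lemma moment_le (al del : R) g u v : 0 < al < 1 -> 0 < del -> generator T g u ->
  Rintegral (@lebesgue_measure R) `]0, +oo[ (fun t => t `^ (al - 1) * ip (T t u) v) <=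
  K * `|u| * `|v| * (al^-1 * del `^ al) + 2 * (K * `|g| * `|v|) * del `^ (al - 1).
Proof.
move=> /andP[al0 al1] del0 gen.
set c1 := K * `|u| * `|v|; set c2 := K * `|g| * `|v|.
have c10 : 0 <= c1 by rewrite !mulr_ge0.
have c20 : 0 <= c2 by rewrite !mulr_ge0.
have aln : al != 0 by rewrite gt_eqF.
have cp (a : R) : pcont (fun t : R => t `^ a).
  apply: (@pderiv_cont R (fun t => t `^ a) (fun t => a * t `^ (a - 1))).
  exact: powR_pderiv.
have cf : pcont (fun t => ip (T t u) v) by exact: orbit_pcont.
have cF : pcont (fun t => ip (T t g) v) by exact: orbit_pcont.
have fb t : 0 < t -> `|ip (T t u) v| <= c1 * expR (- (w * t)).
  move=> t0; apply: le_trans (ip_le hip _ _) _; rewrite /c1 mulrAC ler_wpM2r//.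
  by rewrite mulrAC Tb// ltW.
have Fb t : 0 < t -> `|ip (T t g) v| <= c2.
  by move=> t0; apply: le_trans (ip_le hip _ _) _; rewrite ler_wpM2r// Tn// ltW.
have fb1 t : 0 < t -> `|ip (T t u) v| <= c1.
  move=> t0; apply: le_trans (fb t t0) _; rewrite ler_piMr//.
  by rewrite -expR0 ler_expR oppr_le0 mulr_ge0// ltW.
have de : pderiv (fun t => expR (- (w * t))) (fun t => - w * expR (- (w * t))).
  move=> t t0; apply: is_derive_eq.
  by rewrite /GRing.scale /= !mulr1 mulrC.
have ce := pderiv_cont de.
have dZ (c : R) (F f : R -> R) : pderiv F f -> pderiv (fun t => c * F t) (fun t => c * f t).
  by move=> dF t t0; have := dF t t0 => ?; apply: is_deriveZ.
have d1 : pderiv (fun t => c1 * (al^-1 * t `^ al)) (fun t => c1 * t `^ (al - 1)).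
  move=> t t0; have := dZ c1 _ _ (dZ al^-1 _ _ (@powR_pderiv al)) t t0.
  by rewrite mulKf.
have cc1 : pcont (fun t => c1 * t `^ (al - 1)) by apply: pcontM => //; exact: pcont_cst.
(* A majorant that keeps the exponential factor, for absolute convergence at infinity. *)
pose G t := t `^ (al - 1) * (c1 * expR (- (w * t))).
pose q := c1 * del `^ (al - 1).
have q0 : 0 <= q by rewrite mulr_ge0// powR_ge0.
have cG : pcont G by apply: pcontM => //; apply: pcontM => //; exact: pcont_cst.
apply: (@improper_le _ _ G del _ (c1 * (al^-1 * del `^ al) + q / w * expR (- (w * del))) del0) => //.
- exact: pcontM.
- by move=> t t0; rewrite normrM ger0_norm ?powR_ge0// ler_wpM2l ?powR_ge0// fb.
- move=> a b a0 ad db.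
  apply: le_trans (@Rintegral_le_split _ G del _ _ (fun t => - (q / w) * expR (- (w * t)))
    (fun t => - (q / w) * (- w * expR (- (w * t)))) a b cG d1 cc1 (dZ _ _ _ de) _ a0 ad db _ _) _.
  + by apply: pcontM; [exact: pcont_cst|apply: pcontM => //; exact: pcont_cst].
  + move=> t /andP[t0 _]; rewrite /G /= mulrCA ler_wpM2l// ler_piMr ?powR_ge0//.
    by rewrite -expR0 ler_expR oppr_le0 mulr_ge0// ltW.
  + move=> t dt.
    have -> : - (q / w) * (- w * expR (- (w * t))) = c1 * (del `^ (al - 1) * expR (- (w * t))).
      by rewrite /q; field; rewrite gt_eqF.
    rewrite /G mulrCA ler_wpM2l//.
    by rewrite ler_wpM2r ?expR_ge0// powR_neg_le//; lra.
  + have h1 : 0 <= c1 * (al^-1 * a `^ al) by rewrite !mulr_ge0 ?invr_ge0 ?(ltW al0) ?powR_ge0.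
    have h2 : 0 <= q / w * expR (- (w * b)) by rewrite mulr_ge0 ?expR_ge0// divr_ge0// ltW.
    lra.
- move=> a b a0 ad db.
  (* Integration by parts as a comparison: subtracting [c2] makes the extra term (al - 1) t^(al - 2)
     (<T(t) g, v> - c2) nonnegative, so this derivative dominates the integrand. *)
  have dP : pderiv (fun t => t `^ (al - 1) * ip (T t g) v + - c2 * t `^ (al - 1))
      (fun t => t `^ (al - 1) * ip (T t u) v + (al - 1) * t `^ (al - 1 - 1) * (ip (T t g) v - c2)).
    move=> t t0; have i1 := @powR_pderiv (al - 1) t t0; have i2 := orbit_pderiv v gen t0.
    have i3 := dZ (- c2) _ _ (@powR_pderiv (al - 1)) t t0.
    have i4 := is_deriveM i1 i2.
    have [i5 i6] := is_deriveD i4 i3.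
    apply: DeriveDef; first exact: i5.
    rewrite [LHS]i6 /GRing.scale /=; ring.
  have cP : pcont (fun t => t `^ (al - 1) * ip (T t u) v + (al - 1) * t `^ (al - 1 - 1) * (ip (T t g) v - c2)).
    apply: pcontD; first exact: pcontM.
    apply: pcontM; first by apply: pcontM => //; exact: pcont_cst.
    by apply: pcontD => //; exact: pcont_cst.
  apply: le_trans (Rintegral_le_split _ d1 cc1 dP cP a0 ad db _ _) _.
  + exact: pcontM.
  + move=> t /andP[t0 _]; rewrite mulrC ler_wpM2r ?powR_ge0//.
    by apply: le_trans (ler_norm _) (fb1 t t0).
  + move=> t dt; rewrite lerDl.
    have t0 := lt_le_trans del0 dt.
    rewrite -mulrA -mulrNN mulr_ge0//; first by lra.
    rewrite -mulrN mulr_ge0 ?powR_ge0//.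
    by rewrite opprB subr_ge0 (le_trans (ler_norm _))// Fb.
  + have h1 : 0 <= c1 * (al^-1 * a `^ al) by rewrite !mulr_ge0 ?invr_ge0 ?(ltW al0) ?powR_ge0.
    have p x : 0 <= x `^ (al - 1) by exact: powR_ge0.
    have h2 : b `^ (al - 1) * (ip (T b g) v - c2) <= 0.
      rewrite mulr_ge0_le0 ?p// subr_le0 (le_trans (ler_norm _))// Fb//.
      exact: lt_trans db.
    have h3 : del `^ (al - 1) * (- ip (T del g) v) <= del `^ (al - 1) * c2.
      by rewrite ler_wpM2l// (le_trans (ler_norm _))// normrN Fb.
    lra.
Qed.

Lemma sg_comm E h : 0 < h -> lin E ->
  (forall x, generator T (E x) (h^-1 *: (E x - x))) ->
  (forall z a, generator T z a -> E (z - h *: a) = z) ->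
  forall t x, 0 <= t -> T t (E x) = E (T t x).
Proof.
move=> h0 El EA AE t x t0.
rewrite -[LHS](AE _ _ (gen_sg hT t0 (EA x))) -(linZ (Tl t0)) -(linB (Tl t0)).
by rewrite scalerA mulfV ?gt_eqF// scale1r opprB addrCA subrr addr0.
Qed.

(** (-A)^{-al} commutes with each step 2 E - I. As the integral is weak, the step is moved to the
    test vector through E^*, and brought back under the integral by [sg_comm]. *)
Lemma neg_frac_steps al s z a x z' a' y : (forall n, 0 < s n) ->
  steps (generator T) s z a x -> steps (generator T) s z' a' y ->
  neg_frac_pow ip T al (y 0%N) (x 0%N) ->
  forall n, neg_frac_pow ip T al (y n) (x n).
Proof.
move=> s0 hx hy h0; elim=> // n IH v.
have [E [El EA AE Eb]] := generator_resolvents hT Tb w0 K0 (s0 n).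
have E1 u : `|E u| <= K * (1 + w * s n)^-1 * `|u|.
  by have := Eb 1%N u; rewrite expr1.
have [F [Fl EF]] := adjoint_exists hip El E1.
have step X Z B : steps (generator T) s Z B X -> X n.+1 = E (X n) + (E (X n) - X n).
  move=> hX; have [gz e1 e2] := hX n.
  have Ez : E (X n) = Z n by rewrite e1 AE.
  by rewrite Ez e2 e1 opprB [Z n + (_ - Z n)]addrCA subrr addr0.
have dual u : ip (E u + (E u - u)) v = ip u (F v + (F v - v)).
  by rewrite !(bilDl bip) !(bilDr bip) !(bilNl bip) !(bilNr bip) !EF.
rewrite (step _ _ _ hx) dual (IH _); congr (_ * _); apply: eq_Rintegral => t.
rewrite inE /= in_itv /= andbT => t0; congr (_ * _).
have comm := sg_comm (s0 n) El EA AE _ (ltW t0).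
rewrite (step _ _ _ hy) !(linD (Tl (ltW t0))) (linN (Tl (ltW t0))) !comm.
by rewrite dual.
Qed.

End FractionalPowers.

(** * The two decay rates *)

Lemma norm_le_ip (R : realType) (H : completeNormedModType R) (ip : H -> H -> R)
  (c : R) (x y : H) : inner_product ip -> 0 <= c ->
  ip x x <= c ^+ 2 * ip y y -> `|x| <= c * `|y|.
Proof.
move=> hip c0; rewrite !(ip_norm hip) -exprMn ler_pXn2r ?nnegrE ?mulr_ge0//.
Qed.

Theorem theorem3p3 (R : realType) (H : completeNormedModType R)
  (ip : H -> H -> R) (T : R -> H -> H) (tau : nat -> R) :
  inner_product ip -> C0_semigroup T -> exp_stable T -> inv_generates_bounded T ->
  (exists c C : R, 0 < c /\ forall n, c <= tau n <= C) ->
  (forall alpha : R, 0 < alpha < 1 ->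
     exists K : R, 0 < K /\
       forall (x : nat -> H) (y : H), crank_nicolson T tau x ->
         neg_frac_pow ip T alpha y (x 0%N) ->
         forall n : nat, (1 <= n)%N ->
           `|x n| <= K * (n%:R) `^ (- (alpha / 2)) * `|y|) /\
  (exists K : R, 0 < K /\
     forall (x : nat -> H) (a : H), crank_nicolson T tau x ->
       generator T (x 0%N) a ->
       forall n : nat, (2 <= n)%N ->
         `|x n| <= K * Num.sqrt (ln (n%:R) / n%:R) * `|a|).
Proof.
move=> hip hT [K [w [/ltW K0 [w0 Tb]]]] [S [hS [ST [M0 Sb]]]] [c0 [C0 [c00 htau]]].
pose s n := tau n / 2; pose c := c0 / 2; pose C := C0 / 2.
have c_gt0 : 0 < c by rewrite divr_gt0.
have hs n : c <= s n <= C.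
  by have /andP[h1 h2] := htau n; apply/andP; split; rewrite ler_wpM2r ?invr_ge0.
have s0 n : 0 < s n by have /andP[h _] := hs n; exact: lt_le_trans h.
have hA := generator_resolvents hT Tb w0 K0.
pose M := `|M0|.
have hAV kap : 0 < kap -> resolvents M kap (fun v b => generator T (b + kap *: v) v).
  move=> kap0.
  have Sb' : exp_bounded M (0 + kap) (rescale kap S).
    apply: rescale_bounded => t x t0; rewrite mul0r oppr0 expR0 mulr1.
    by apply: le_trans (Sb t x t0) _; rewrite ler_wpM2r// ler_norm.
  rewrite add0r in Sb'.
  apply: resolvents_iff (generator_resolvents (rescale_C0 kap hS) Sb' kap0 (normr_ge0 _)) => v b.
  split=> [g|/ST g].
    apply/ST; have := rescale_generator (lam := - kap) g.
    by rewrite rescaleK scaleNr opprK.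
  by have := rescale_generator (lam := kap) g; rewrite addrK.
have cn_steps x : crank_nicolson T tau x -> exists z a, steps (generator T) s z a x.
  move=> /choice[z /choice[a h]]; exists z, a => n.
  by have [? [? ?]] := h n.
have Alin : forall k z a z' a', generator T z a -> generator T z' a' ->
    generator T (k *: z + z') (k *: a + a').
  by move=> k z a z' a'; exact: gen_lin.
have [D D0 hD] := graph_decay hip C w0 c_gt0 hA hAV Alin.
have decay z a x b n : (0 < n)%N -> steps (generator T) s z a x ->
    generator T (x 0%N) b -> ip (x n) (x n) <= D / n%:R * ip b b.
  move=> n0 hx g; have np : 0 < n%:R :> R by rewrite ltr0n.
  by rewrite mulrAC ler_pdivlMr// mulrC (hD s z a x b n hs hx g).
split=> [al hal|]; last first.
  have l2 : 0 < ln (2 : R) by rewrite ln_gt0// ltr1n.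
  (* The rate n^{-1/2} is already available; dividing by ln 2 <= ln n inserts the logarithm. *)
  exists (Num.sqrt (D / ln 2)); split; first by rewrite sqrtr_gt0 divr_gt0.
  move=> x a /cn_steps[z [b hx]] g n n2.
  have np : 0 < n%:R :> R by rewrite ltr0n (leq_trans _ n2).
  have lnn : ln 2 <= ln (n%:R : R) by rewrite ler_ln ?posrE// ler_nat.
  apply: (norm_le_ip hip); first by rewrite mulr_ge0 ?sqrtr_ge0.
  apply: le_trans (decay _ _ _ _ _ _ hx g) _; first exact: leq_trans n2.
  rewrite ler_wpM2r ?(ip_ge0 hip)// exprMn !sqr_sqrtr; last 2 first.
  - by rewrite divr_ge0 ?(ltW np)// (le_trans (ltW l2)).
  - by rewrite divr_ge0// ltW.
  rewrite mulrA ler_wpM2r ?invr_ge0 ?(ltW np)//.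
  by rewrite mulrAC ler_pdivlMr// ler_wpM2l// ltW.
pose CE := energy_const K w M c C + 1.
have CE0 : 0 <= CE by rewrite addr_ge0 ?energy_const_ge0.
pose L := (Gamma al)^-1 * (K * CE * al^-1 + 2 * (K * Num.sqrt D)).
have [al0 al1] := andP hal.
have G0 : 0 <= (Gamma al)^-1.
  rewrite invr_ge0; apply: Rintegral_ge0 => t _.
  by rewrite mulr_ge0 ?powR_ge0 ?expR_ge0.
have L0 : 0 <= L.
  rewrite mulr_ge0// addr_ge0//; last by rewrite !mulr_ge0 ?sqrtr_ge0.
  by rewrite !mulr_ge0// invr_ge0 ltW.
exists (L + 1); split; first by rewrite ltr_wpDl.
move=> x y0 /cn_steps[z [b hx]] hfrac n n1.
have np : 0 < n%:R :> R by rewrite ltr0n.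
have [z1 [b1 [y [hy y00]]]] := steps_exist y0 hA s0.
(* Three runs share the step sizes: x, the orbit y of (-A)^al x_0, and the orbit g of A^{-1} y_0.
   [steps_lift] keeps A g_n = y_n, so g_n has the decay of [graph_decay]. *)
have [g00 gen0] := generator_surj hT Tb w0 K0 y0.
have [z2 [b2 [g [hg g0]]]] := steps_exist g00 hA s0.
rewrite -g0 -y00 in gen0.
have [gen _] := steps_lift hA Alin s0 hg hy gen0 n.
rewrite -y00 in hfrac *.
(* Testing against x_n itself turns the weak formula into one for |x_n|^2. *)
have fr := neg_frac_steps hip hT Tb w0 K0 s0 hx hy hfrac n (x n).
pose del : R := n%:R `^ (- 2^-1).
have del0 : 0 < del by rewrite powR_gt0.
have del_al : del `^ al = n%:R `^ (- (al / 2)).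
  by rewrite /del -powRrM mulNr mulrC.
have yb : `|y n| <= CE * `|y 0%N|.
  by apply: (norm_le_ip hip CE0); exact: (power_bounded hip w0 c_gt0 hA hAV n hs hy).
have gb : `|g n| <= Num.sqrt D * del * `|y 0%N|.
  apply: (norm_le_ip hip); first by rewrite mulr_ge0 ?sqrtr_ge0// ltW.
  apply: le_trans (decay _ _ _ _ _ n1 hg gen0) _.
  rewrite exprMn sqr_sqrtr ?(ltW D0)// /del -powR_mulrn ?powR_ge0// -powRrM.
  by rewrite mulNr mulVf// powRN powRr1// ltW.
have mom := moment_le hip hT Tb w0 K0 (x n) hal del0 gen.
have [->|xn0] := eqVneq (x n) 0.
  by rewrite normr0 !mulr_ge0 ?powR_ge0// addr_ge0.
have xp : 0 < `|x n| by rewrite normr_gt0.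
have KL : `|x n| <= L * n%:R `^ (- (al / 2)) * `|y 0%N|.
  rewrite -(ler_pM2r xp) -expr2 -(ip_norm hip) fr.
  apply: le_trans (ler_wpM2l G0 mom) _.
  have -> : L * n%:R `^ (- (al / 2)) * `|y 0%N| * `|x n| =
      (Gamma al)^-1 * (K * (CE * `|y 0%N|) * `|x n| * (al^-1 * del `^ al) +
      2 * (K * (Num.sqrt D * del * `|y 0%N|) * `|x n|) * del `^ (al - 1)).
    have <- : del * del `^ (al - 1) = n%:R `^ (- (al / 2)) by rewrite mulr_powRB1// ltW.
    rewrite -(mulr_powRB1 (ltW del0) al0) /L; ring.
  rewrite ler_wpM2l//; apply: lerD.
    rewrite ler_wpM2r ?mulr_ge0 ?invr_ge0 ?(ltW al0) ?powR_ge0//.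
    by rewrite ler_wpM2r// ler_wpM2l.
  by rewrite ler_wpM2r ?powR_ge0// ler_wpM2l// ler_wpM2r// ler_wpM2l.
by apply: le_trans KL _; rewrite ler_wpM2r// ler_wpM2r ?powR_ge0// lerDl.
Qed.
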